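(* Let $\mathcal{N}:x\mapsto\rho_x$ be a classical-quantum (CQ) channel with finite input alphabet $\mathcal{X}$ and output states $\rho_x$ on a finite-dimensional Hilbert space. For any $\alpha\in[\tfrac12,1]$, any probability distribution $p$ on $\mathcal{X}$, and any rate $r\ge 0$, \[ \lim_{n\to\infty}\frac{-1}{n}\log P_e^{(n)}(\mathcal{N},r)\;\ge\;\frac{1-\alpha}{\alpha}\bigl[I_{\alpha}(\mathcal{N},p)-r\bigr]. \]
   Context: For a sequence $x^n=(x_1,\dots,x_n)\in\mathcal{X}^n$ put $\rho_{x^n}=\rho_{x_1}\otimes\cdots\otimes\rho_{x_n}$. A code for $n$ uses of the channel with $M$ messages consists of codewords $x^n_1,\dots,x^n_M\in\mathcal{X}^n$ and a POVM $\{\Lambda_1,\dots,\Lambda_M\}$ on $\mathcal{H}^{\otimes n}$ ($\Lambda_m\ge0$, $\sum_m\Lambda_m=\mathbb{1}$); its rate is $\frac{\log M}{n}$ and its (average) error probability is $P_e=1-\frac1M\sum_{m=1}^M\operatorname{tr}[\Lambda_m\rho_{x^n_m}]$. $P_e^{(n)}(\mathcal{N},r)$ denotes the infimum of $P_e$ over all codes for $n$ uses with $M=2^{nr}$ messages. The Petz Rényi divergence is $D_\alpha(\rho\|\sigma)=\frac{1}{\alpha-1}\log\operatorname{tr}[\rho^\alpha\sigma^{1-\alpha}]$ (for $\rho\ll\sigma$). For a distribution $p$ on $\mathcal{X}$, with $\rho_{XB}=\sum_x p_x|x\rangle\langle x|\otimes\rho_x$ and $\rho_X=\sum_x p_x|x\rangle\langle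 x|$, define $I_\alpha(\mathcal{N},p)=\min_{\sigma_B}D_\alpha(\rho_{XB}\|\rho_X\otimes\sigma_B)$, the minimum over quantum states $\sigma_B$; for $\alpha\in(0,1)$ this equals $\frac{\alpha}{\alpha-1}\log\operatorname{tr}\bigl[(\sum_x p_x\rho_x^\alpha)^{1/\alpha}\bigr]$, and at $\alpha=1$ it is the usual (Umegaki) mutual information. *)

(* Defs.v *)
From HB Require Import structures.
From mathcomp Require Import all_boot all_order all_algebra.
From mathcomp Require Import sesquilinear spectral.
From mathcomp Require Import complex.
From mathcomp Require Import all_classical all_reals all_analysis.

Set Implicit Arguments.
Unset Strict Implicit.
Unset Printing Implicit Defensive.

Import Order.TTheory GRing.Theory Num.Theory.
Local Open Scope ring_scope.
Local Open Scope classical_set_scope.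

Definition adjmx (R : realType) m n (A : 'M[R[i]]_(m, n)) : 'M[R[i]]_(n, m) :=
  \matrix_(i, j) (A j i)^*.

Definition psd (R : realType) n (A : 'M[R[i]]_n) : Prop :=
  adjmx A = A /\ forall v : 'rV[R[i]]_n, 0 <= (v *m A *m adjmx v) 0 0.

Definition density (R : realType) n (A : 'M[R[i]]_n) : Prop :=
  psd A /\ \tr A = 1.

(* functional calculus for normal (in particular Hermitian) matrices:
   A = U^-1 diag(l) U  ==>  f(A) = U^-1 diag(f(l)) U, f applied to the real
   part of each eigenvalue (eigenvalues of Hermitian matrices are real). *)
Definition mxfun (R : realType) (f : R -> R) n (A : 'M[R[i]]_n) : 'M[R[i]]_n :=
  invmx (spectralmx A) *m
  diag_mx (map_mx (fun z : R[i] => (f (complex.Re z))%:C%C) (spectral_diag A))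
  *m spectralmx A.

Definition log2 (R : realType) (x : R) : R := ln x / ln 2.

(* A^s for a PSD matrix A and real s (0^s = 0 for s > 0, via powR) *)
Definition mxpow (R : realType) n (A : 'M[R[i]]_n) (s : R) : 'M[R[i]]_n :=
  mxfun (fun x => x `^ s) A.

(* base-2 matrix logarithm of a PSD matrix, taken on its support
   (the convention 0 log 0 = 0; only used when the support condition holds) *)
Definition mxlog2 (R : realType) n (A : 'M[R[i]]_n) : 'M[R[i]]_n :=
  mxfun (fun x => if 0 < x then log2 x else 0) A.

Definition supp_le (R : realType) n (rho sigma : 'M[R[i]]_n) : bool :=
  (kermx sigma <= kermx rho)%MS.

Definition petzD (R : realType) n (alpha : R) (rho sigma : 'M[R[i]]_n) : \bar R :=
  if ~~ supp_le rho sigma then +oo%E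
  else if alpha == 1 then
    (complex.Re (\tr (rho *m (mxlog2 rho - mxlog2 sigma))))%:E
  else
    ((alpha - 1)^-1 *
       log2 (complex.Re (\tr (mxpow rho alpha *m mxpow sigma (1 - alpha)))))%:E.

(* Matrices on the Hilbert space with orthonormal basis indexed by a finType T *)
Definition mxT (R : realType) (T : finType) (f : T -> T -> R[i]) : 'M[R[i]]_#|T| :=
  \matrix_(i, j) f (enum_val i) (enum_val j).

(* rho_XB = sum_x p_x |x><x| (x) rho_x  on  X (x) B  (basis X * 'I_d) *)
Definition cq_state (R : realType) (X : finType) d (p : X -> R)
    (rho : X -> 'M[R[i]]_d) : 'M[R[i]]_#|{: X * 'I_d}| :=
  mxT (fun a b : X * 'I_d =>
         if a.1 == b.1 then (p a.1)%:C%C * rho a.1 a.2 b.2 else 0).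

(* rho_X (x) sigma_B *)
Definition prod_state (R : realType) (X : finType) d (p : X -> R)
    (sigma : 'M[R[i]]_d) : 'M[R[i]]_#|{: X * 'I_d}| :=
  mxT (fun a b : X * 'I_d =>
         if a.1 == b.1 then (p a.1)%:C%C * sigma a.2 b.2 else 0).

Definition I_alpha (R : realType) (X : finType) d (rho : X -> 'M[R[i]]_d)
    (p : X -> R) (alpha : R) : \bar R :=
  ereal_inf [set petzD alpha (cq_state p rho) (prod_state p sigma) |
             sigma in [set sigma : 'M[R[i]]_d | density sigma]].

(* rho_{x^n} = rho_{x_1} (x) ... (x) rho_{x_n}, on basis {ffun 'I_n -> 'I_d} *)
Definition tens_state (R : realType) (X : finType) d (rho : X -> 'M[R[i]]_d)
    n (xn : {ffun 'I_n -> X}) : 'M[R[i]]_#|{: {ffun 'I_n -> 'I_d}}| :=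
  mxT (fun a b : {ffun 'I_n -> 'I_d} => \prod_(k < n) rho (xn k) (a k) (b k)).

Definition povm (R : realType) N M (L : 'I_M -> 'M[R[i]]_N) : Prop :=
  (forall m, psd (L m)) /\ \sum_(m < M) L m = 1%:M.

Definition err_prob (R : realType) (X : finType) d (rho : X -> 'M[R[i]]_d)
    n M (c : 'I_M -> {ffun 'I_n -> X})
    (L : 'I_M -> 'M[R[i]]_#|{: {ffun 'I_n -> 'I_d}}|) : R :=
  1 - M%:R^-1 * \sum_(m < M) complex.Re (\tr (L m *m tens_state rho (c m))).

Definition num_msgs (R : realType) (n : nat) (r : R) : nat :=
  `|Num.ceil ((2 : R) `^ (n%:R * r))|%N.

Definition Pe (R : realType) (X : finType) d (rho : X -> 'M[R[i]]_d)
    (n : nat) (r : R) : R :=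
  inf [set e : R | exists (c : 'I_(num_msgs n r) -> {ffun 'I_n -> X})
                     (L : 'I_(num_msgs n r) -> 'M[R[i]]_#|{: {ffun 'I_n -> 'I_d}}|),
                     povm L /\ e = err_prob rho c L].

Definition err_exponent (R : realType) (X : finType) d (rho : X -> 'M[R[i]]_d)
    (r : R) (n : nat) : \bar R :=
  if Pe rho n r == 0 then +oo%E
  else ((- (n%:R)^-1) * log2 (Pe rho n r))%:E.

(* Main.v *)
Require Import Defs.
From HB Require Import structures.
From mathcomp Require Import all_boot all_order all_algebra.
From mathcomp Require Import sesquilinear spectral.
From mathcomp Require Import complex.
From mathcomp Require Import all_classical all_reals all_analysis.
From mathcomp Require Import ring lra.
Import Order.TTheory GRing.Theory Num.Theory.
Local Open Scope ring_scope.

Set Implicit Arguments.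
Unset Strict Implicit.
Unset Printing Implicit Defensive.

(* Write s = (1 - alpha) / alpha, so alpha = 1 / (1 + s), and let A_m be the
   alpha-th power of the state of the m-th codeword. Decode with the pretty good
   measurement G A_m G, where B = sum_m A_m and G = B^(-1/2). The crux is a
   matrix inequality: with C = B - A_m, for every t > 0 and every Hermitian
   0 <= R <= 1,
     tr [A (A + t)^-1 A (1 - G A G)] <= tr [A (1 - R)] + t^-1 tr [A R C R].
   (with A = A_m). The right-hand side is linear in the interference C, so it
   can be averaged over a random code using pairwise independence only: if A' is
   the mean of A_m, D = (M - 1) A' that of C, and R = t (D + t)^-1, the average
   is at most 2 tr [A' D (D + t)^-1] <= 2 t^-s tr [A' D^s]. Since A_m has spectrum in
   {0} u [2^(-nN), 1], its power A_m^(1 + s), which is the state, is dominated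
   by 4 sum_t t^s A (A + t)^-1 A over the nN + 1 dyadic values t = 2^-j. Hence
     Pe <= 8 (nN + 1) (M - 1)^s (tr (sum_x p_x rho_x^alpha)^(1/alpha))^n,
   and the prefactor is harmless. Finally the normalised
   (sum_x p_x rho_x^alpha)^(1/alpha), inserted for sigma_B, shows that
   s I_alpha is at most - log of the trace on the right. *)

(** * Adjoints, traces and unitarily diagonal matrices *)

(* Locked: otherwise rewriting with lemmas on [*m] looks inside. *)
HB.lock Definition udiag (R : realType) n (V : 'M[R[i]]_n) (l : 'I_n -> R) : 'M[R[i]]_n :=
  adjmx V *m diag_mx (\row_i (l i)%:C%C) *m V.

Section Adjoint.
Variable R : realType.
Local Notation C := R[i].
Implicit Types (m n p : nat).

Lemma adjmxE m n (A : 'M[C]_(m, n)) : adjmx A = (map_mx Num.conj A)^T.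
Proof. by apply/matrixP=> i j; rewrite !mxE. Qed.

Lemma adjmxK m n (A : 'M[C]_(m, n)) : adjmx (adjmx A) = A.
Proof. by apply/matrixP=> i j; rewrite !mxE conjCK. Qed.

Lemma adjmxD m n (A B : 'M[C]_(m, n)) : adjmx (A + B) = adjmx A + adjmx B.
Proof. by apply/matrixP=> i j; rewrite !mxE rmorphD. Qed.

Lemma adjmxN m n (A : 'M[C]_(m, n)) : adjmx (- A) = - adjmx A.
Proof. by apply/matrixP=> i j; rewrite !mxE rmorphN. Qed.

Lemma adjmxB m n (A B : 'M[C]_(m, n)) : adjmx (A - B) = adjmx A - adjmx B.
Proof. by rewrite adjmxD adjmxN. Qed.

Lemma adjmx0 m n : adjmx (0 : 'M[C]_(m, n)) = 0.
Proof. by apply/matrixP=> i j; rewrite !mxE rmorph0. Qed.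

Lemma adjmxM m n p (A : 'M[C]_(m, n)) (B : 'M[C]_(n, p)) :
  adjmx (A *m B) = adjmx B *m adjmx A.
Proof. by rewrite !adjmxE map_mxM trmx_mul. Qed.

Lemma conjC_real (x : R) : (x%:C%C)^* = x%:C%C :> C.
Proof. exact: conjc_real. Qed.

Lemma adjmxZ m n (a : R) (A : 'M[C]_(m, n)) :
  adjmx (a%:C%C *: A) = a%:C%C *: adjmx A.
Proof. by apply/matrixP=> i j; rewrite !mxE rmorphM /= conjC_real. Qed.

Lemma adjmx1 n : adjmx (1%:M : 'M[C]_n) = 1%:M.
Proof. by rewrite adjmxE map_mx1 trmx1. Qed.

Definition rtr n (A : 'M[C]_n) : R := complex.Re (\tr A).

Lemma ReD (x y : C) : complex.Re (x + y) = complex.Re x + complex.Re y.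
Proof. by case: x y => [a b] [c d]. Qed.

Lemma ReN (x : C) : complex.Re (- x) = - complex.Re x.
Proof. by case: x. Qed.

Lemma ReZ (a : R) (x : C) : complex.Re (a%:C%C * x) = a * complex.Re x.
Proof. by case: x => b c /=; rewrite mul0r subr0. Qed.

Lemma Re_sum I (r : seq I) (P : pred I) (F : I -> C) :
  complex.Re (\sum_(i <- r | P i) F i) = \sum_(i <- r | P i) complex.Re (F i).
Proof. by apply: (big_morph _ ReD). Qed.

Lemma ReC (x : C) : complex.Re x^* = complex.Re x.
Proof. by case: x. Qed.

Lemma Re_mulCJ_ge0 (x : C) : 0 <= complex.Re (x * x^*).
Proof. by have := mul_conjC_ge0 x; rewrite lecE => /andP[]. Qed.

Lemma Re_mulCJ_le0 (x : C) : complex.Re (x * x^*) <= 0 -> x = 0.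
Proof.
move=> h; apply/eqP; rewrite -normr_eq0 -sqrf_eq0 normCK.
have := mul_conjC_ge0 x; move: h.
by rewrite lecE eq_complex /= => h /andP[/eqP -> h0]; rewrite eqxx andbT eq_le h h0.
Qed.

Lemma rtrD n (A B : 'M[C]_n) : rtr (A + B) = rtr A + rtr B.
Proof. by rewrite /rtr mxtraceD ReD. Qed.

Lemma rtrN n (A : 'M[C]_n) : rtr (- A) = - rtr A.
Proof. by rewrite /rtr linearN /= ReN. Qed.

Lemma rtrB n (A B : 'M[C]_n) : rtr (A - B) = rtr A - rtr B.
Proof. by rewrite rtrD rtrN. Qed.

Lemma rtr0 n : rtr (0 : 'M[C]_n) = 0.
Proof. by rewrite /rtr mxtrace0. Qed.

Lemma rtrZ n (a : R) (A : 'M[C]_n) : rtr (a%:C%C *: A) = a * rtr A.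
Proof. by rewrite /rtr mxtraceZ ReZ. Qed.

Lemma rtr_sum n I (r : seq I) (P : pred I) (F : I -> 'M[C]_n) :
  rtr (\sum_(i <- r | P i) F i) = \sum_(i <- r | P i) rtr (F i).
Proof. by apply: (big_morph _ (@rtrD n) (rtr0 n)). Qed.

Lemma rtrC m n (A : 'M[C]_(m, n)) (B : 'M[C]_(n, m)) :
  rtr (A *m B) = rtr (B *m A).
Proof. by rewrite /rtr mxtrace_mulC. Qed.

Lemma rtr_adj n (A : 'M[C]_n) : rtr (adjmx A) = rtr A.
Proof.
by rewrite /rtr /mxtrace !Re_sum; apply: eq_bigr => i _; rewrite mxE ReC.
Qed.

End Adjoint.

(** * Positive semidefinite matrices and the functional calculus *)

Section Psd.
Variable R : realType.
Local Notation C := R[i].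
Implicit Types (m n p : nat).

Lemma psd_congr m n (A : 'M[C]_n) (X : 'M[C]_(m, n)) :
  psd A -> psd (X *m A *m adjmx X).
Proof.
move=> [hA pA]; split; first by rewrite !adjmxM adjmxK hA mulmxA.
move=> v; have := pA (v *m X); rewrite adjmxM !mulmxA.
by congr (0 <= _); congr (fun_of_matrix _ 0 0); rewrite !mulmxA.
Qed.

Lemma psd1 n : psd (1%:M : 'M[C]_n).
Proof.
split=> [|v]; first exact: adjmx1.
rewrite mulmx1 mxE; apply: sumr_ge0 => i _.
by rewrite !mxE mul_conjC_ge0.
Qed.

Lemma psd_gram m n (X : 'M[C]_(m, n)) : psd (X *m adjmx X).
Proof. by have := psd_congr X (psd1 n); rewrite mulmx1. Qed.

Lemma psd0 n : psd (0 : 'M[C]_n).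
Proof. by split=> [|v]; rewrite ?adjmx0 // mulmx0 mul0mx mxE. Qed.

Lemma psdD n (A B : 'M[C]_n) : psd A -> psd B -> psd (A + B).
Proof.
move=> [hA pA] [hB pB]; split; first by rewrite adjmxD hA hB.
by move=> v; rewrite mulmxDr mulmxDl mxE addr_ge0.
Qed.

Lemma psd_sum n I (r : seq I) (P : pred I) (F : I -> 'M[C]_n) :
  (forall i, P i -> psd (F i)) -> psd (\sum_(i <- r | P i) F i).
Proof. by move=> h; elim/big_ind: _ => //; [exact: psd0|exact: psdD]. Qed.

Lemma psdZ n (a : R) (A : 'M[C]_n) : 0 <= a -> psd A -> psd (a%:C%C *: A).
Proof.
move=> a0 [hA pA]; split; first by rewrite adjmxZ hA.
move=> v; rewrite -scalemxAr -scalemxAl mxE mulr_ge0 //.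
by rewrite ler0c.
Qed.

Lemma mul_adj_delta n (X : 'rV[C]_n) i : (X *m adjmx (delta_mx 0 i : 'rV[C]_n)) 0 0 = X 0 i.
Proof.
rewrite mxE (bigD1 i) //= big1 ?addr0 => [|j ji].
  by rewrite !mxE !eqxx rmorph1 mulr1.
by rewrite !mxE (negbTE ji) andbF rmorph0 mulr0.
Qed.

Lemma psd_rtr_ge0 n (A : 'M[C]_n) : psd A -> 0 <= rtr A.
Proof.
move=> [hA pA]; rewrite /rtr /mxtrace Re_sum; apply: sumr_ge0 => i _.
have := pA (delta_mx 0 i); rewrite -rowE.
rewrite mul_adj_delta mxE.
by rewrite lecE => /andP[_].
Qed.

Definition unitary n (V : 'M[C]_n) := V *m adjmx V = 1%:M.

Lemma unitaryV n (V : 'M[C]_n) : unitary V -> adjmx V *m V = 1%:M.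
Proof. exact: mulmx1C. Qed.

Lemma udiagM n (V : 'M[C]_n) (l l' : 'I_n -> R) : unitary V ->
  udiag V l *m udiag V l' = udiag V (fun i => l i * l' i).
Proof.
move=> uV; rewrite !udiag.unlock !mulmxA -(mulmxA _ V (adjmx V)) uV mulmx1.
rewrite -(mulmxA (adjmx V)) mulmx_diag; congr (_ *m diag_mx _ *m _).
by apply/rowP=> i; rewrite !mxE -rmorphM.
Qed.

Lemma adj_udiag n (V : 'M[C]_n) l : adjmx (udiag V l) = udiag V l.
Proof.
rewrite !udiag.unlock !adjmxM adjmxK mulmxA; congr (_ *m _ *m _).
apply/matrixP=> i j; rewrite !mxE eq_sym rmorphMn /= conjC_real.
by case: eqP => [->|].
Qed.

Lemma eq_udiag n (V : 'M[C]_n) l l' : l =1 l' -> udiag V l = udiag V l'.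
Proof.
by move=> e; rewrite !udiag.unlock; congr (_ *m diag_mx _ *m _); apply/rowP=> i; rewrite !mxE e.
Qed.

Lemma udiag1 n (V : 'M[C]_n) : unitary V -> udiag V (fun=> 1) = 1%:M.
Proof.
move=> uV; rewrite !udiag.unlock; have -> : (\row_i 1%:C%C) = const_mx 1 :> 'rV[C]_n.
  by apply/rowP=> i; rewrite !mxE.
by rewrite diag_const_mx mulmx1 unitaryV.
Qed.

Lemma udiagD n (V : 'M[C]_n) l l' :
  udiag V l + udiag V l' = udiag V (fun i => l i + l' i).
Proof.
rewrite !udiag.unlock -mulmxDl -mulmxDr -linearD /=; congr (_ *m diag_mx _ *m _).
by apply/rowP=> i; rewrite !mxE rmorphD.
Qed.

Lemma udiagZ n (V : 'M[C]_n) a l :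
  a%:C%C *: udiag V l = udiag V (fun i => a * l i).
Proof.
rewrite !udiag.unlock scalemxAl scalemxAr; congr (_ *m _ *m _).
by apply/matrixP=> i j; rewrite !mxE rmorphM /= mulrnAr.
Qed.

Lemma udiagB n (V : 'M[C]_n) l l' :
  udiag V l - udiag V l' = udiag V (fun i => l i - l' i).
Proof.
rewrite -scaleN1r; have -> : (-1 : C) = (-1 : R)%:C%C by rewrite rmorphN1.
by rewrite udiagZ udiagD; apply: eq_udiag => i; rewrite mulN1r.
Qed.

Lemma rtr_udiag n (V : 'M[C]_n) l : unitary V -> rtr (udiag V l) = \sum_i l i.
Proof.
move=> uV; rewrite !udiag.unlock -mulmxA rtrC -mulmxA uV mulmx1 /rtr /mxtrace Re_sum.
by apply: eq_bigr => i _; rewrite !mxE eqxx.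
Qed.

Lemma psd_udiag n (V : 'M[C]_n) l : (forall i, 0 <= l i) -> psd (udiag V l).
Proof.
move=> l0; pose W : 'M[C]_n := adjmx V *m diag_mx (\row_i (Num.sqrt (l i))%:C%C).
suff -> : udiag V l = W *m adjmx W by exact: psd_gram.
rewrite /W adjmxM adjmxK !udiag.unlock !mulmxA; congr (_ *m _).
rewrite -mulmxA; congr (_ *m _).
have -> : adjmx (diag_mx (\row_i (Num.sqrt (l i))%:C%C)) =
          diag_mx (\row_i (Num.sqrt (l i))%:C%C) :> 'M[C]_n.
  apply/matrixP=> i j; rewrite !mxE eq_sym rmorphMn /= conjC_real.
  by case: eqP => [->|].
rewrite mulmx_diag; congr diag_mx; apply/rowP=> i; rewrite !mxE -rmorphM /=.
by rewrite -expr2 sqr_sqrtr.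
Qed.

Definition eigs n (A : 'M[C]_n) (i : 'I_n) : R := complex.Re (spectral_diag A 0 i).

Lemma unitary_spectralmx n (A : 'M[C]_n) : unitary (spectralmx A).
Proof.
have /unitarymxP := spectral_unitarymx A.
by rewrite /unitary adjmxE map_trmx.
Qed.

Lemma invmx_spectralmx n (A : 'M[C]_n) : invmx (spectralmx A) = adjmx (spectralmx A).
Proof.
have h := unitary_spectralmx A.
by rewrite -[LHS]mulmx1 -h mulKmx ?spectral_unit.
Qed.

Lemma mxfunE (f : R -> R) n (A : 'M[C]_n) :
  mxfun f A = udiag (spectralmx A) (fun i => f (eigs A i)).
Proof.
rewrite /mxfun invmx_spectralmx !udiag.unlock; congr (_ *m diag_mx _ *m _).
by apply/rowP=> i; rewrite !mxE.
Qed.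

Lemma herm_udiag n (A : 'M[C]_n) : adjmx A = A -> A = udiag (spectralmx A) (eigs A).
Proof.
move=> hA; have hs : A \is hermsymmx.
  by apply/is_hermitianmxP; rewrite expr0 scale1r -map_trmx -adjmxE hA.
have := hermitian_normalmx hs => /orthomx_spectralP {1}->.
rewrite invmx_spectralmx !udiag.unlock; congr (_ *m diag_mx _ *m _).
apply/rowP=> i; rewrite !mxE /eigs.
have /mxOverP/(_ 0 i) := hermitian_spectral_diag_real hs.
by move=> /RRe_real ->.
Qed.

(** The functional calculus does not depend on the diagonalisation: the overlap matrix
    [V *m adjmx W] intertwines the two diagonals, so wherever its [(i, j)] entry is nonzero the
    eigenvalues [l i] and [l' j] agree, and then so do their images under [f]. *)
Lemma udiag_intertwine n (V W : 'M[C]_n) (f : R -> R) l l' :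
  unitary V -> unitary W -> udiag V l = udiag W l' ->
  udiag V (fun i => f (l i)) = udiag W (fun i => f (l' i)).
Proof.
move=> uV uW e; pose X := V *m adjmx W.
have comm : forall g, (diag_mx (\row_i (g (l i))%:C%C) *m X =
      X *m diag_mx (\row_i (g (l' i))%:C%C)) <->
      udiag V (fun i => g (l i)) = udiag W (fun i => g (l' i)).
  move=> g; split=> [h|h].
    have : adjmx V *m (diag_mx (\row_i (g (l i))%:C%C) *m X) *m W =
           adjmx V *m (X *m diag_mx (\row_i (g (l' i))%:C%C)) *m W by rewrite h.
    rewrite /X !mulmxA -(mulmxA _ (adjmx W) W) (unitaryV uW) mulmx1.
    by rewrite (unitaryV uV) mul1mx !udiag.unlock.
  have : V *m udiag V (fun i => g (l i)) *m adjmx W =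
         V *m udiag W (fun i => g (l' i)) *m adjmx W by rewrite h.
  rewrite !udiag.unlock !mulmxA uV mul1mx -!mulmxA uW mulmx1 -/X.
  by rewrite !mulmxA.
apply/(comm f); have /(comm id) := e; move: (X) => Y h.
apply/matrixP=> i j; have := congr1 (fun M : 'M[C]_n => M i j) h.
rewrite !mul_diag_mx !mul_mx_diag !mxE => hij.
have [x0|xN0] := eqVneq (Y i j) 0; first by rewrite x0 mulr0 mul0r.
have : (l i)%:C%C = (l' j)%:C%C :> C.
  by apply: (mulIf xN0); rewrite hij mulrC.
by move=> /complexI ->; rewrite mulrC.
Qed.

Lemma mxfun_udiag (f : R -> R) n (V : 'M[C]_n) l : unitary V ->
  mxfun f (udiag V l) = udiag V (fun i => f (l i)).
Proof.
move=> uV; rewrite mxfunE; apply: udiag_intertwine => //.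
  exact: unitary_spectralmx.
by rewrite -herm_udiag // adj_udiag.
Qed.

Lemma eigs_ge0 n (A : 'M[C]_n) i : psd A -> 0 <= eigs A i.
Proof.
move=> pA; have := psd_congr (spectralmx A) pA => -[_ /(_ (delta_mx 0 i))].
have uV := unitary_spectralmx A.
rewrite {2}(herm_udiag pA.1) !udiag.unlock !mulmxA -(mulmxA _ _ (adjmx (spectralmx A))).
rewrite uV mulmx1 -(mulmxA _ (spectralmx A) (adjmx _)) uV mulmx1 -rowE.
rewrite mul_adj_delta !mxE eqxx mulr1n.
by rewrite ler0c.
Qed.

Lemma psdP n (A : 'M[C]_n) : psd A ->
  exists V l, [/\ unitary V, forall i, 0 <= l i & A = udiag V l].
Proof.
move=> pA; exists (spectralmx A), (eigs A); split.
- exact: unitary_spectralmx.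
- by move=> i; exact: eigs_ge0.
- exact: herm_udiag pA.1.
Qed.

Lemma psd_sqrt n (A : 'M[C]_n) : psd A -> exists X : 'M[C]_n, A = X *m adjmx X.
Proof.
move=> /psdP[V [l [uV l0 ->]]]; exists (udiag V (fun i => Num.sqrt (l i))).
rewrite adj_udiag udiagM //; apply: eq_udiag => i.
by rewrite -expr2 sqr_sqrtr.
Qed.

Lemma psd_rtrM_ge0 n (A B : 'M[C]_n) : psd A -> psd B -> 0 <= rtr (A *m B).
Proof.
move=> pA /psd_sqrt[X ->]; rewrite mulmxA rtrC mulmxA.
apply: psd_rtr_ge0; have := psd_congr (adjmx X) pA.
by rewrite adjmxK.
Qed.

Lemma rtr_gram_eq0 m n (Y : 'M[C]_(m, n)) : rtr (Y *m adjmx Y) <= 0 -> Y = 0.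
Proof.
move=> h; apply/matrixP=> i j; rewrite mxE.
have e : rtr (Y *m adjmx Y) = \sum_i \sum_j complex.Re (Y i j * (Y i j)^*).
  rewrite /rtr /mxtrace Re_sum; apply: eq_bigr => k _; rewrite mxE Re_sum.
  by apply: eq_bigr => l _; rewrite mxE.
apply: Re_mulCJ_le0; apply: le_trans h.
rewrite e (bigD1 i) //= (bigD1 j) //= -addrA lerDl.
rewrite addr_ge0 ?sumr_ge0 // => k _; first exact: Re_mulCJ_ge0.
by apply: sumr_ge0 => l _; exact: Re_mulCJ_ge0.
Qed.

End Psd.

(** * The pretty good measurement *)

Section OneShot.
Variable R : realType.
Local Notation C := R[i].

Lemma psd_diag_ge0 n (A : 'M[C]_n) k : psd A -> 0 <= complex.Re (A k k).
Proof.
move=> [_ /(_ (delta_mx 0 k))]; rewrite -rowE mul_adj_delta mxE.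
by rewrite lecE => /andP[_].
Qed.

Lemma quad_udiagE n m (V : 'M[C]_n) l (X Z : 'M[C]_(n, m)) k :
  complex.Re ((adjmx X *m udiag V l *m Z) k k) =
  \sum_i l i * complex.Re (((V *m X) i k)^* * (V *m Z) i k).
Proof.
rewrite !udiag.unlock !mulmxA -adjmxM -mulmxA mul_mx_diag mxE Re_sum.
apply: eq_bigr => i _; rewrite -ReZ; congr complex.Re.
by rewrite !mxE mulrCA mulrA.
Qed.

(** For [b > 0] put [q = sqrt b]: AM-GM gives [2 q <= th + b / th], and what remains is
    [|y - c q u|^2 / q >= 0]. For [b = 0] the vector entry [y] vanishes, so the right side is 0 and
    the left side is at most 0. *)
Lemma scalar_inv_sqrt_bound (b c th : R) (y u : C) : 0 <= b -> 0 < th ->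
  (b = 0 -> y = 0) ->
  2 * c * complex.Re (y^* * u) - c ^+ 2 / 2 * (th + b / th) * complex.Re (u^* * u)
  <= b `^ (- 2^-1) * complex.Re (y^* * y).
Proof.
move=> b0 th0 hy; case: u => u1 u2.
have e1 (z w : C) : complex.Re (z^* * w) =
  complex.Re z * complex.Re w + complex.Im z * complex.Im w.
  by case: z w => [z1 z2] [w1 w2] /=; rewrite mulNr opprK.
rewrite !e1 /=.
have [bE|bN0] := eqVneq b 0.
  rewrite hy //= bE; have := mulr_ge0 (mulr_ge0 (sqr_ge0 c) (ltW th0))
    (addr_ge0 (sqr_ge0 u1) (sqr_ge0 u2)); nra.
have bp : 0 < b by rewrite lt0r bN0.
case: y {hy} => y1 y2 /=.
pose q := Num.sqrt b; have q0 : 0 < q by rewrite sqrtr_gt0.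
have qq : b = q * q by rewrite -expr2 sqr_sqrtr.
have -> : b `^ (- 2^-1) = q^-1 by rewrite powRN powR12_sqrt.
have amgm : 2 * q <= th + b / th.
  rewrite qq -subr_ge0.
  have -> : th + q * q / th - 2 * q = (th - q) ^+ 2 / th.
    by field; rewrite gt_eqF.
  by rewrite divr_ge0 ?sqr_ge0 // ltW.
set v := u1 * u1 + u2 * u2.
have v0 : 0 <= v by rewrite addr_ge0 // -expr2 sqr_ge0.
apply: (@le_trans _ _ (2 * c * (y1 * u1 + y2 * u2) - c ^+ 2 * q * v)).
  rewrite lerD2l lerN2; have := mulr_ge0 (mulr_ge0 (sqr_ge0 c) v0).
  by move=> /(_ (th + b / th - 2 * q)); rewrite subr_ge0 => /(_ amgm); lra.
rewrite -subr_ge0.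
have -> : q^-1 * (y1 * y1 + y2 * y2) - (2 * c * (y1 * u1 + y2 * u2) - c ^+ 2 * q * v)
  = ((y1 - c * q * u1) ^+ 2 + (y2 - c * q * u2) ^+ 2) / q.
  by rewrite /v; field; rewrite gt_eqF.
by rewrite divr_ge0 ?addr_ge0 ?sqr_ge0 // ltW.
Qed.

(* The weight [b + th^2] replaces [2 th sqrt b] by AM-GM: the price is a free
   parameter [th], the gain is a bound that is linear in the matrix under the
   inverse square root. *)
Lemma inv_sqrt_bound n m (V : 'M[C]_n) (b : 'I_n -> R) (X Z : 'M[C]_(n, m)) k (c th : R) :
  unitary V -> (forall i, 0 <= b i) -> 0 < th ->
  (forall i, b i = 0 -> (V *m X) i k = 0) ->
  2 * c * complex.Re ((adjmx X *m Z) k k) - c ^+ 2 / 2 *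
    (th * complex.Re ((adjmx Z *m Z) k k) +
     complex.Re ((adjmx Z *m udiag V b *m Z) k k) / th)
  <= complex.Re ((adjmx X *m udiag V (fun i => b i `^ (- 2^-1)) *m X) k k).
Proof.
move=> uV b0 th0 hX.
(* Inserting [udiag V (fun=> 1)] turns every term into a sum over the eigenbasis of [V], to be
   compared summand by summand. *)
rewrite -[adjmx X *m Z](_ : adjmx X *m udiag V (fun=> 1) *m Z = _); last first.
  by rewrite udiag1 // mulmx1.
rewrite -[adjmx Z *m Z](_ : adjmx Z *m udiag V (fun=> 1) *m Z = _); last first.
  by rewrite udiag1 // mulmx1.
rewrite !quad_udiagE mulr_sumr [th * _]mulr_sumr mulr_suml -big_split /= mulr_sumr -sumrB.
apply: ler_sum => i _.
have := @scalar_inv_sqrt_bound (b i) c th ((V *m X) i k) ((V *m Z) i k) (b0 i) th0 (hX i).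
apply: le_trans; rewrite le_eqVlt; apply/orP; left; apply/eqP; ring.
Qed.

Lemma rtr_mul_udiag n (X F : 'M[C]_n) w :
  rtr (X *m udiag F w) = \sum_k w k * complex.Re ((F *m X *m adjmx F) k k).
Proof.
rewrite !udiag.unlock !mulmxA rtrC !mulmxA /rtr /mxtrace Re_sum.
by apply: eq_bigr => k _; rewrite mul_mx_diag !mxE -ReZ mulrC.
Qed.

(** Trace form of the antitonicity of the inverse. With [Y = (A + t)^-1] and [N = La + t <= A + t],
    positivity of [(1 - Y N) N^-1 (1 - Y N)^*] gives [tr N^-1 - 2 tr Y + tr [Y N Y] >= 0], and [tr
    [Y N Y] <= tr [Y (A + t) Y] = tr Y]. *)
Lemma sum_inv_antitone n (W F : 'M[C]_n) (a la : 'I_n -> R) (t : R) :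
  unitary W -> unitary F -> 0 < t -> (forall i, 0 <= a i) -> (forall i, 0 <= la i) ->
  psd (udiag W a - udiag F la) ->
  \sum_i (a i + t)^-1 <= \sum_i (la i + t)^-1.
Proof.
move=> uW uF t0 a0 l0 hle.
pose Y := udiag W (fun i => (a i + t)^-1).
pose N := udiag F (fun i => la i + t).
pose Ni := udiag F (fun i => (la i + t)^-1).
have lt0 i : la i + t != 0 by rewrite gt_eqF // ltr_wpDl.
have at0 i : a i + t != 0 by rewrite gt_eqF // ltr_wpDl.
have pNi : psd Ni by apply: psd_udiag => i; rewrite invr_ge0 addr_ge0 // ltW.
have NiN : Ni *m N = 1%:M.
  by rewrite udiagM // -(udiag1 uF); apply: eq_udiag => i; rewrite mulVf.
have NNi : N *m Ni = 1%:M by exact: mulmx1C.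
have hY : adjmx Y = Y by rewrite adj_udiag.
have hN : adjmx N = N by rewrite adj_udiag.
have := psd_rtr_ge0 (psd_congr (1%:M - Y *m N) pNi).
have -> : (1%:M - Y *m N) *m Ni *m adjmx (1%:M - Y *m N) =
          Ni - Y - Y + Y *m (N *m Y).
  rewrite adjmxB adjmx1 adjmxM hY hN mulmxBl mul1mx -(mulmxA Y) NNi mulmx1.
  rewrite mulmxBr mulmx1 mulmxBl (mulmxA Ni) NiN mul1mx.
  by rewrite opprB addrA [RHS]addrAC.
rewrite rtrD !rtrB => h.
suff : rtr (Y *m (N *m Y)) <= rtr Y.
  move: h; rewrite !rtr_udiag // => h1 h2; lra.
have := psd_rtr_ge0 (psd_congr Y hle); rewrite hY.
have -> : udiag W a = udiag W (fun i => a i + t) - t%:C%C *: 1%:M.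
  by rewrite -(udiag1 uW) udiagZ udiagB; apply: eq_udiag => i; ring.
have -> : udiag F la = N - t%:C%C *: 1%:M.
  by rewrite -(udiag1 uF) udiagZ udiagB; apply: eq_udiag => i; ring.
have aY : udiag W (fun i => a i + t) *m Y = 1%:M.
  by rewrite udiagM // -(udiag1 uW); apply: eq_udiag => i; rewrite mulfV.
by rewrite opprB addrA addrNK mulmxBr mulmxBl rtrB -!mulmxA aY mulmx1 subr_ge0.
Qed.

Lemma unitary_udiagK n (V : 'M[C]_n) l : unitary V ->
  V *m udiag V l *m adjmx V = diag_mx (\row_i (l i)%:C%C).
Proof.
by move=> uV; rewrite udiag.unlock !mulmxA uV mul1mx -mulmxA uV mulmx1.
Qed.

(** The squared norm of row [i] of [V *m K] is a diagonal entry of [V K K^* V^*], which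
    [K K^* <= udiag V b] squeezes between 0 and [b i]. *)
Lemma dominated_kernel n m (V A : 'M[C]_n) (K : 'M[C]_(n, m)) b i j :
  unitary V -> psd A -> K *m adjmx K + A = udiag V b -> b i = 0 ->
  (V *m K) i j = 0.
Proof.
move=> uV pA eB bi.
have h1 := psd_diag_ge0 i (psd_congr V pA).
have : complex.Re ((V *m udiag V b *m adjmx V) i i) = 0.
  by rewrite unitary_udiagK // !mxE eqxx bi.
rewrite -eB mulmxDr mulmxDl mxE ReD => h2.
have {h1 h2} : complex.Re ((V *m (K *m adjmx K) *m adjmx V) i i) <= 0.
  by move: h1; rewrite -[X in _ -> X <= _]addr0 -h2 lerD2l.
rewrite mulmxA -mulmxA -adjmxM mxE Re_sum.
have e k : complex.Re ((V *m K) i k * adjmx (V *m K) k i) =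
           complex.Re ((V *m K) i k * ((V *m K) i k)^*) by rewrite [X in _ * X]mxE.
rewrite (bigD1 j) //= => h; apply: Re_mulCJ_le0.
rewrite -e; apply: le_trans h; rewrite lerDl sumr_ge0 // => k _.
by rewrite e Re_mulCJ_ge0.
Qed.

(* Completing the square in [L - P *m U] with respect to [P^-1]. *)
Lemma completed_square n m (P Q : 'M[C]_n) (L U : 'M[C]_(n, m)) :
  adjmx P = P -> psd Q -> P *m Q = 1%:M ->
  2 * rtr (adjmx L *m U) - rtr (adjmx U *m P *m U) <= rtr (adjmx L *m Q *m L).
Proof.
move=> hP pQ PQ; have QP : Q *m P = 1%:M by exact: mulmx1C.
have := psd_rtr_ge0 (psd_congr (adjmx L - adjmx U *m P) pQ).
have -> : (adjmx L - adjmx U *m P) *m Q *m adjmx (adjmx L - adjmx U *m P) =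
   adjmx L *m Q *m L - adjmx L *m U - (adjmx U *m L - adjmx U *m P *m U).
  rewrite adjmxB adjmxM !adjmxK hP mulmxBl -(mulmxA _ P Q) PQ mulmx1.
  rewrite mulmxBr !mulmxBl -(mulmxA _ Q (P *m U)) (mulmxA Q) QP mul1mx.
  by rewrite (mulmxA (adjmx U)) !opprB addrACA [RHS]addrACA [- _ + _ in RHS]addrC.
rewrite !rtrB -[rtr (adjmx U *m L)]rtr_adj adjmxM adjmxK; lra.
Qed.

(** Write [q = sqrt la]. The last hypothesis is what [inv_sqrt_bound] yields for [c = 1 / q] and
    [th = q]; it simplifies to [y >= q - kap / (2 q^3)]. Multiplying by [q^3 / (q^2 + t)] gives the
    claim with slack [q^2 kap / (2 t (q^2 + t))]. *)
Lemma scalar_weight_bound (la t kap z y : R) : 0 < la -> 0 < t -> 0 <= kap ->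
  z <= la ->
  2 * (Num.sqrt la)^-1 * la - (Num.sqrt la)^-1 ^+ 2 / 2 *
    (Num.sqrt la * z + (la * la + kap) / Num.sqrt la) <= y ->
  la ^+ 2 / (la + t) - (2 * t)^-1 * kap <= la * (Num.sqrt la / (la + t)) * y.
Proof.
move=> la0 t0 kap0; pose q := Num.sqrt la; have q0 : 0 < q by rewrite sqrtr_gt0.
have qq : la = q ^+ 2 by rewrite sqr_sqrtr // ltW.
have d0 : 0 < q ^+ 2 + t by rewrite addr_gt0 // -qq.
rewrite -/q qq => hz hy.
have h1 : q - kap / (2 * q ^+ 3) <= y.
  apply: le_trans hy; rewrite -subr_ge0.
  have -> : 2 / q * q ^+ 2 - q^-1 ^+ 2 / 2 *
     (q * z + (q ^+ 2 * q ^+ 2 + kap) / q) - (q - kap / (2 * q ^+ 3)) =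
     (q ^+ 2 - z) / (2 * q).
    by field; rewrite gt_eqF.
  by rewrite divr_ge0 ?subr_ge0 // mulr_ge0 // ltW.
have c0 : 0 <= q ^+ 2 * (q / (q ^+ 2 + t)).
  by apply: mulr_ge0; [exact: sqr_ge0|exact: divr_ge0 (ltW q0) (ltW d0)].
apply: le_trans (ler_wpM2l c0 h1); rewrite -subr_ge0.
have -> : q ^+ 2 * (q / (q ^+ 2 + t)) * (q - kap / (2 * q ^+ 3)) -
  ((q ^+ 2) ^+ 2 / (q ^+ 2 + t) - (2 * t)^-1 * kap) =
  q ^+ 2 * kap / (2 * t * (q ^+ 2 + t)).
  by field; rewrite !gt_eqF.
apply: divr_ge0; first exact: mulr_ge0 (sqr_ge0 q) kap0.
by apply: mulr_ge0 (ltW d0); apply: mulr_ge0 => //; exact: ltW.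
Qed.

(* Since [0 `^ (- 2^-1) = 0], the inverse square root is the one on the support. *)
Lemma pgm_bound n (W V Rr Cc : 'M[C]_n) (a b : 'I_n -> R) (t : R) :
  unitary W -> unitary V -> (forall i, 0 <= a i) -> (forall i, 0 <= b i) -> 0 < t ->
  adjmx Rr = Rr -> psd (Rr - Rr *m Rr) -> psd (1%:M - Rr) -> psd Cc ->
  udiag W a + Cc = udiag V b ->
  rtr (udiag W (fun i => a i ^+ 2 / (a i + t)) *m
       (1%:M - udiag V (fun i => b i `^ (- 2^-1)) *m udiag W a *m
               udiag V (fun i => b i `^ (- 2^-1)))) <=
  rtr (udiag W a *m (1%:M - Rr)) + t^-1 * rtr (udiag W a *m Rr *m Cc *m Rr).
Proof.
move=> uW uV a0 b0 t0 hR pRR p1R pC eB.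
have [A eA] : exists A, A = udiag W a by eexists.
have [G eG] : exists G, G = udiag V (fun i => b i `^ (- 2^-1)) by eexists.
have [g defg] : exists g, g = udiag W (fun i => a i ^+ 2 / (a i + t)) by eexists.
rewrite -eA -eG -defg.
have [K eK] : exists K, K = udiag W (fun i => Num.sqrt (a i)) by eexists.
have KK : K *m K = A.
  by rewrite eK eA udiagM //; apply: eq_udiag => i; rewrite -expr2 sqr_sqrtr.
have hK : adjmx K = K by rewrite eK adj_udiag.
have hA : adjmx A = A by rewrite eA adj_udiag.
have hG : adjmx G = G by rewrite eG adj_udiag.
have pR : psd Rr.
  have := psdD pRR (psd_gram Rr); rewrite hR addrNK.
  by [].
(* [M = A^(1/2) R A^(1/2)] is the part of [A] that [R] retains; it lies below [A], and the estimates
   are made in its eigenbasis [F]. *)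
have [M defM] : exists M, M = K *m Rr *m K by eexists.
have pM : psd M by have := psd_congr K pR; rewrite hK -defM.
have [F [la [uF l0 eM]]] := psdP pM.
have at0 i : a i + t != 0 by rewrite gt_eqF // ltr_wpDl.
have lt0 i : 0 < la i + t by rewrite ltr_wpDl.
have lN0 i : la i + t != 0 by rewrite gt_eqF.
(* Without interference the bound from [completed_square] is [2 la^(3/2) tau - tau^2 la (la + t)]
   per eigenvector; this [tau] maximises it, with maximum [la^2 / (la + t)]. *)
pose tau i := Num.sqrt (la i) / (la i + t).
have [Tau eT] : exists Tau, Tau = udiag F tau by eexists.
have hT : adjmx Tau = Tau by rewrite eT adj_udiag.
pose U := Rr *m K *m Tau.
have [P defP] : exists P, P = udiag W (fun i => a i + t) by eexists.
have [Q defQ] : exists Q, Q = udiag W (fun i => (a i + t)^-1) by eexists.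
have hP : adjmx P = P by rewrite defP adj_udiag.
have PQ : P *m Q = 1%:M.
  by rewrite defP defQ udiagM // -(udiag1 uW); apply: eq_udiag => i; rewrite mulfV.
have pQ : psd Q.
  by rewrite defQ; apply: psd_udiag => i; rewrite invr_ge0 addr_ge0 // ltW.
have eg : g = A *m Q *m A.
  rewrite defg eA defQ !udiagM //; apply: eq_udiag => i.
  by rewrite expr2 mulrAC.
pose L := A *m G *m K.
have step1 : 2 * rtr (adjmx L *m U) - rtr (adjmx U *m P *m U) <=
             rtr (g *m (G *m A *m G)).
  suff <- : rtr (adjmx L *m Q *m L) = rtr (g *m (G *m A *m G)).
    exact: completed_square.
  rewrite /L !adjmxM hK hG hA eg -!mulmxA rtrC -!mulmxA KK.
  by rewrite rtrC -!mulmxA.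
have MT : M *m Tau = udiag F (fun i => la i * tau i) by rewrite eM eT udiagM.
have step2 : rtr (adjmx L *m U) = \sum_k (la k * tau k) *
    complex.Re ((F *m (K *m G *m K) *m adjmx F) k k).
  rewrite -rtr_mul_udiag -MT /L !adjmxM hK hG hA -KK /U defM.
  by rewrite -!mulmxA.
have tau2 i : tau i ^+ 2 = la i / (la i + t) ^+ 2.
  by rewrite expr_div_n sqr_sqrtr.
(* [R^2 <= R] bounds the quadratic term by a function of [M] alone, [Tau (M^2 + t M) Tau]. *)
have step3 : rtr (adjmx U *m P *m U) <= \sum_k la k ^+ 2 / (la k + t).
  have eP : P = A + t%:C%C *: 1%:M.
    by rewrite defP eA -(udiag1 uW) udiagZ udiagD; apply: eq_udiag => i; rewrite mulr1.
  have -> : adjmx U *m P *m U = Tau *m (M *m M) *m Tau +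
      t%:C%C *: (Tau *m (K *m (Rr *m Rr) *m K) *m Tau).
    rewrite /U !adjmxM hK hT hR eP mulmxDr mulmxDl -scalemxAr mulmx1 -scalemxAl.
    by rewrite defM -KK -!mulmxA.
  have h := psd_rtr_ge0 (psd_congr (Tau *m K) pRR).
  rewrite !adjmxM hT hK in h.
  have e : Tau *m K *m (Rr - Rr *m Rr) *m (K *m Tau) =
      Tau *m M *m Tau - Tau *m (K *m (Rr *m Rr) *m K) *m Tau.
    by rewrite mulmxBr mulmxBl defM -!mulmxA.
  rewrite e rtrB subr_ge0 in h.
  rewrite rtrD rtrZ; apply: le_trans (_ : rtr (Tau *m (M *m M) *m Tau) +
     t * rtr (Tau *m M *m Tau) <= _); first by rewrite lerD2l ler_pM2l.
  rewrite eM eT !udiagM // !rtr_udiag // mulr_sumr -big_split /=.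
  apply: ler_sum => i _; rewrite le_eqVlt; apply/orP; left; apply/eqP.
  transitivity (tau i ^+ 2 * (la i ^+ 2 + t * la i)); first by ring.
  by rewrite tau2; field.
(* [kap k] is the interference seen along the [k]-th eigenvector of [M]. *)
have [kap kapE] : exists kap, forall k,
    complex.Re ((F *m (K *m Rr *m Cc *m Rr *m K) *m adjmx F) k k) = kap k.
  by eexists.
have kap0 k : 0 <= kap k.
  have := psd_diag_ge0 k (psd_congr (F *m K *m Rr) pC).
  by rewrite -kapE !adjmxM hK hR -!mulmxA.
have sum_kap : \sum_k kap k = rtr (A *m Rr *m Cc *m Rr).
  transitivity (rtr (K *m Rr *m Cc *m Rr *m K)).
    rewrite -[in RHS](mulmx1 (K *m Rr *m Cc *m Rr *m K)) -(udiag1 uF) rtr_mul_udiag.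
    by apply: eq_bigr => k _; rewrite mul1r kapE.
  rewrite rtrC !mulmxA KK.
  by [].
have step4 k : la k ^+ 2 / (la k + t) - (2 * t)^-1 * kap k <=
   (la k * tau k) * complex.Re ((F *m (K *m G *m K) *m adjmx F) k k).
  have [lE|lN] := eqVneq (la k) 0.
    rewrite lE expr0n /= !mul0r sub0r oppr_le0 mulr_ge0 //.
    by rewrite invr_ge0 mulr_ge0 // ltW.
  have lp : 0 < la k by rewrite lt0r lN l0.
  pose q := Num.sqrt (la k); have qp : 0 < q by rewrite sqrtr_gt0.
  have qq : la k = q ^+ 2 by rewrite sqr_sqrtr.
  have hker i : b i = 0 -> (V *m (K *m adjmx F)) i k = 0.
    move=> bi; rewrite mulmxA mxE big1 // => j _.
    have -> := @dominated_kernel _ _ V Cc K b i j uV pC _ bi; first by rewrite mul0r.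
    by rewrite hK KK eA.
  (* With [Z = R K F^*], the entries of [Z^* Z] and [Z^* B Z] are at most [la] and equal to
     [la^2 + kap]; [th = q] balances [th la] against [la^2 / th]. *)
  have := inv_sqrt_bound (Rr *m K *m adjmx F) q^-1 uV b0 qp hker; rewrite -eG.
  have -> : adjmx (K *m adjmx F) *m (Rr *m K *m adjmx F) = F *m M *m adjmx F.
    by rewrite adjmxM adjmxK hK defM -!mulmxA.
  have -> : adjmx (K *m adjmx F) *m G *m (K *m adjmx F) =
            F *m (K *m G *m K) *m adjmx F.
    by rewrite adjmxM adjmxK hK -!mulmxA.
  have -> : adjmx (Rr *m K *m adjmx F) *m udiag V b *m (Rr *m K *m adjmx F) =
      F *m (M *m M) *m adjmx F + F *m (K *m Rr *m Cc *m Rr *m K) *m adjmx F.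
    rewrite -eB -eA mulmxDr mulmxDl !adjmxM adjmxK hK hR defM -KK.
    by rewrite -!mulmxA.
  have eF f : complex.Re ((F *m udiag F f *m adjmx F) k k) = f k.
    by rewrite unitary_udiagK // !mxE eqxx.
  have e1 : complex.Re ((F *m M *m adjmx F) k k) = la k by rewrite eM eF.
  have e2 (Y : 'M[C]_n) : complex.Re ((F *m (M *m M) *m adjmx F + Y) k k) =
      la k * la k + complex.Re (Y k k).
    by rewrite mxE ReD eM udiagM // eF.
  have hZ : complex.Re ((adjmx (Rr *m K *m adjmx F) *m (Rr *m K *m adjmx F)) k k) <= la k.
    have := psd_diag_ge0 k (psd_congr (F *m K) pRR).
    rewrite mulmxBr mulmxBl !adjmxM adjmxK hK hR mxE ReD.
    have -> : F *m K *m Rr *m (K *m adjmx F) = F *m M *m adjmx F by rewrite defM -!mulmxA.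
    rewrite e1 [X in _ + complex.Re X]mxE ReN subr_ge0.
    by rewrite -!mulmxA.
  rewrite e1 e2 kapE /tau -/q => hy.
  exact: scalar_weight_bound (kap0 k) hZ hy.
(* By [x^2 / (x + t) = x - t + t^2 / (x + t)] the linear parts differ by [tr A - tr M = tr
   [A (1 - R)]], and the resolvent parts compare by [sum_inv_antitone], as [M <= A]. *)
have step5 : \sum_k a k ^+ 2 / (a k + t) - rtr (A *m (1%:M - Rr)) <=
             \sum_k la k ^+ 2 / (la k + t).
  have hle : psd (udiag W a - udiag F la).
    rewrite -eA -eM -KK.
    have -> : K *m K - M = K *m (1%:M - Rr) *m adjmx K.
      by rewrite hK mulmxBr mulmxBl mulmx1 defM.
    exact: psd_congr.
  have h := sum_inv_antitone uW uF t0 a0 l0 hle.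
  have e (x : R) : x + t != 0 -> x ^+ 2 / (x + t) = x - t + t ^+ 2 * (x + t)^-1.
    by move=> xt; field.
  under eq_bigr do rewrite e //.
  under [X in _ <= X]eq_bigr do rewrite e //.
  rewrite !big_split /= -!mulr_sumr mulmxBr mulmx1 rtrB.
  have -> : rtr (A *m Rr) = rtr M by rewrite defM [RHS]rtrC mulmxA KK.
  rewrite eM eA !rtr_udiag //.
  have := ler_wpM2l (sqr_ge0 t) h; lra.
have eg' : rtr g = \sum_k a k ^+ 2 / (a k + t) by rewrite defg rtr_udiag.
rewrite mulmxBr mulmx1 rtrB eg'.
(* The factor 2 on this trace in [step1] turns the coefficient [(2 t)^-1] of the interference into
   the [t^-1] of the claim. *)
have step4' : \sum_k (la k ^+ 2 / (la k + t) - (2 * t)^-1 * kap k) <= rtr (adjmx L *m U).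
  by rewrite step2; apply: ler_sum.
rewrite sumrB -mulr_sumr sum_kap invfM in step4'.
lra.
Qed.

End OneShot.

(** * Random coding *)

Section RandomCode.
Variable R : realType.
Local Notation C := R[i].

(** The operators [G A_m G] sum to the projection onto the support of [sum_m A_m]; the complementary
    projection [S] is given to message 0, which can only enlarge its operator. *)
Lemma pgm_povm n M (A : 'I_M -> 'M[C]_n) (V : 'M[C]_n) b :
  (0 < M)%N -> unitary V -> (forall i, 0 <= b i) -> (forall m, psd (A m)) ->
  \sum_m A m = udiag V b ->
  let G := udiag V (fun i => b i `^ (- 2^-1)) in
  exists L : 'I_M -> 'M[C]_n, povm L /\ forall m, psd (L m - G *m A m *m G).
Proof.
case: M A => // M A _ uV b0 pA eB G.
have hG : adjmx G = G by rewrite adj_udiag.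
pose S := 1%:M - G *m udiag V b *m G.
have pS : psd S.
  rewrite /S -(udiag1 uV) !udiagM // udiagB; apply: psd_udiag => i.
  have [->|bN0] := eqVneq (b i) 0; first by rewrite mulr0 mul0r subr0.
  have bp : 0 < b i by rewrite lt0r bN0 b0.
  rewrite mulrAC -powRD; last by rewrite bN0 implybT.
  have -> : - 2^-1 + - 2^-1 = -1 :> R by lra.
  by rewrite powR_inv1 ?b0 // mulVf // subrr.
have pL m : psd (G *m A m *m G) by have := psd_congr G (pA m); rewrite hG.
exists (fun m => G *m A m *m G + (if m == ord0 then S else 0)); split; last first.
  by move=> m; rewrite addrAC subrr add0r; case: ifP => // _; exact: psd0.
split=> [m|].
  by apply: psdD => //; case: ifP => // _; exact: psd0.
rewrite big_split /= -big_mkcond /= big_pred1_eq.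
rewrite -mulmx_suml -mulmx_sumr eB.
by rewrite addrC /S subrK.
Qed.

(** Clear the denominator. If [t <= y], then [t^s <= y^s] and [y <= y + t]; otherwise
    [t^s y = t^s y^s y^(1 - s) <= y^s t]. *)
Lemma scalar_young (t y s : R) : 0 < t -> 0 <= y -> 0 < s <= 1 ->
  t `^ s * (y / (y + t)) <= y `^ s.
Proof.
move=> t0 y0 /andP[s0 s1].
have [->|yN0] := eqVneq y 0; first by rewrite mul0r mulr0 powR_ge0.
have yp : 0 < y by rewrite lt0r yN0.
rewrite mulrA ler_pdivrMr ?addr_gt0 //.
have [ty|yt] := leP t y.
  apply: ler_pM; [exact: powR_ge0|exact: y0| |by rewrite lerDl ltW].
  by rewrite ge0_ler_powR // ?nnegrE // ltW.
apply: (@le_trans _ _ (y `^ s * t)); last first.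
  by rewrite ler_wpM2l ?powR_ge0 // lerDr.
have e (x : R) : 0 < x -> x = x `^ s * x `^ (1 - s).
  move=> x0; rewrite -powRD ?(gt_eqF x0) ?implybT //.
  by rewrite addrC subrK powRr1 // ltW.
rewrite {1}(e y yp) {2}(e t t0) mulrCA ler_wpM2l ?powR_ge0 //.
rewrite ler_wpM2l ?powR_ge0 //.
by rewrite ge0_ler_powR ?subr_ge0 // ?nnegrE ltW.
Qed.

(** * Averages over a codebook of independent codewords *)

Section Expectation.
Variables (X : finType) (P : X -> R) (M : nat).
Hypothesis P1 : \sum_x P x = 1.

Definition cprob (c : {ffun 'I_M -> X}) : R := \prod_k P (c k).

Lemma cprob_sum : \sum_c cprob c = 1.
Proof.
rewrite /cprob -(bigA_distr_bigA (fun _ => P)) /= big1 // => k _.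
Qed.

Lemma expect_prod (F : 'I_M -> X -> R) :
  \sum_c cprob c * \prod_k F k (c k) = \prod_k \sum_x P x * F k x.
Proof.
by rewrite bigA_distr_bigA; apply: eq_bigr => c _; rewrite /cprob big_split.
Qed.

Lemma expect_at1 m x : \sum_c cprob c * (c m == x)%:R = P x.
Proof.
pose F k y : R := if k == m then (y == x)%:R else 1.
transitivity (\sum_c cprob c * \prod_k F k (c k)).
  apply: eq_bigr => c _; congr (_ * _).
  by rewrite (bigD1 m) //= /F eqxx big1 ?mulr1 // => k /negbTE ->.
rewrite expect_prod (bigD1 m) //= /F eqxx [X in _ * X]big1 => [|k /negbTE ->].
  rewrite mulr1 (bigD1 x) //= eqxx mulr1 big1 ?addr0 // => y /negbTE ->.
  by rewrite mulr0.
by under eq_bigr do rewrite mulr1.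
Qed.

(** The two indicators form a product over all positions, so [expect_prod] factorises the average;
    positions other than [m] and [k] contribute 1. *)
Lemma expect_at2 m k x y : k != m ->
  \sum_c cprob c * ((c m == x)%:R * (c k == y)%:R) = P x * P y.
Proof.
move=> km.
pose F j z : R := if j == m then (z == x)%:R else if j == k then (z == y)%:R else 1.
transitivity (\sum_c cprob c * \prod_j F j (c j)).
  apply: eq_bigr => c _; congr (_ * _).
  rewrite (bigD1 m) //= (bigD1 k) //= /F !eqxx (negbTE km) big1 ?mulr1 //.
  by move=> j /andP[/negbTE -> /negbTE ->].
have one z : \sum_w P w * (w == z)%:R = P z.
  rewrite (bigD1 z) //= eqxx mulr1 big1 ?addr0 // => w /negbTE ->.
  by rewrite mulr0.
rewrite expect_prod (bigD1 m) //= (bigD1 k) //= /F !eqxx (negbTE km) !one.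
rewrite big1 ?mulr1 // => j /andP[/negbTE -> /negbTE ->].
by under eq_bigr do rewrite mulr1.
Qed.

Lemma expect1 (f : X -> R) m : \sum_c cprob c * f (c m) = \sum_x P x * f x.
Proof.
under [RHS]eq_bigr do rewrite -(expect_at1 m) mulr_suml.
rewrite exchange_big /=; apply: eq_bigr => c _.
rewrite (bigD1 (c m)) //= eqxx mulr1 big1 ?addr0 // => x.
by rewrite eq_sym => /negbTE ->; rewrite mulr0 mul0r.
Qed.

Lemma expect2 (f : X -> X -> R) m k : k != m ->
  \sum_c cprob c * f (c m) (c k) = \sum_x \sum_y P x * P y * f x y.
Proof.
move=> km.
under [RHS]eq_bigr do under eq_bigr do rewrite -(expect_at2 _ _ km) mulr_suml.
under [RHS]eq_bigr do rewrite exchange_big /=.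
rewrite exchange_big /=; apply: eq_bigr => c _.
rewrite (bigD1 (c m)) //= (bigD1 (c k)) //= !eqxx !mulr1 big1 ?addr0 => [|y].
  rewrite big1 ?addr0 // => x; rewrite eq_sym => /negbTE -> /=.
  by rewrite big1 // => y _; rewrite mul0r mulr0 mul0r.
by rewrite eq_sym => /negbTE ->; rewrite !mulr0 mul0r.
Qed.

End Expectation.

Lemma povm_compl_psd n M (L : 'I_M -> 'M[C]_n) m : povm L -> psd (1%:M - L m).
Proof.
move=> [pL <-]; rewrite (bigD1 m) //= addrC addrK.
by apply: psd_sum => i _; exact: pL.
Qed.

Lemma rtrM_sumr n (A : 'M[C]_n) I (r : seq I) (Q : pred I) (F : I -> 'M[C]_n) :
  rtr (A *m \sum_(i <- r | Q i) F i) = \sum_(i <- r | Q i) rtr (A *m F i).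
Proof. by rewrite mulmx_sumr rtr_sum. Qed.

(** Everything is diagonal in [V], so the claim is scalar. With [y = mu gam] the first term is
    [gam y / (y + t)] and the second is that times [t / (y + t) <= 1], hence the 2; [scalar_young]
    then gives [gam y^s = mu^s gam^(1 + s)]. *)
Lemma resolvent_cost (n : nat) (V : 'M[C]_n) (gam : 'I_n -> R) (mu t s : R) :
  unitary V -> (forall i, 0 <= gam i) -> 0 <= mu -> 0 < t -> 0 < s <= 1 ->
  t `^ s * (rtr (udiag V gam *m (1%:M - udiag V (fun i => t / (mu * gam i + t)))) +
     mu * (t^-1 * rtr (udiag V gam *m udiag V (fun i => t / (mu * gam i + t)) *m
                       udiag V gam *m udiag V (fun i => t / (mu * gam i + t))))) <=
  2 * mu `^ s * \sum_i gam i `^ (1 + s).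
Proof.
move=> uV g0 mu0 t0 s01.
rewrite -[X in X - _](udiag1 uV) udiagB !udiagM // !rtr_udiag //.
rewrite !mulr_sumr -big_split /= !mulr_sumr; apply: ler_sum => i _.
have y0 : 0 <= mu * gam i by rewrite mulr_ge0.
have d0 : 0 < mu * gam i + t by rewrite ltr_wpDl.
have [s0 s1] := andP s01.
have -> : gam i `^ (1 + s) = gam i * gam i `^ s.
  have [->|gN0] := eqVneq (gam i) 0.
    by rewrite powR0 ?mul0r // gt_eqF // addr_gt0.
  by rewrite powRD ?gN0 ?implybT // powRr1.
have := ler_wpM2l (g0 i) (scalar_young t0 y0 s01); rewrite powRM // => h.
apply: (@le_trans _ _ (2 * (gam i * (t `^ s * (mu * gam i / (mu * gam i + t)))))); last first.
  apply: le_trans (ler_wpM2l (ler0n _ 2) h) _.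
  by rewrite le_eqVlt; apply/orP; left; apply/eqP; ring.
have -> : 1 - t / (mu * gam i + t) = mu * gam i / (mu * gam i + t).
  by field; rewrite gt_eqF.
set y := mu * gam i in y0 d0 h *.
have h2 : mu * (t^-1 * (gam i * (t / (y + t)) * gam i * (t / (y + t)))) <=
          gam i * (y / (y + t)).
  have -> : mu * (t^-1 * (gam i * (t / (y + t)) * gam i * (t / (y + t)))) =
     gam i * (y / (y + t)) * (t / (y + t)).
    rewrite /y; field; apply/andP; split; rewrite gt_eqF //.
  rewrite ler_piMr // ?mulr_ge0 ?invr_ge0 ?(ltW d0) //.
  by rewrite ler_pdivrMr // mul1r lerDr.
have ts0 : 0 <= t `^ s by exact: powR_ge0.
have := ler_wpM2l ts0 h2.
rewrite mulrDr.
have -> : t `^ s * (gam i * (y / (y + t))) = gam i * (t `^ s * (y / (y + t))).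
  by rewrite mulrCA.
lra.
Qed.

(** * Mean error of a random code under the pretty good measurement *)

Section Bound.
Variables (n M : nat) (X : finType) (P : X -> R).
Variables (W : X -> 'M[C]_n) (a r : X -> 'I_n -> R).
Variables (V : 'M[C]_n) (gam : 'I_n -> R) (T : seq R) (s : R).
Hypotheses (M0 : (0 < M)%N) (P0 : forall x, 0 <= P x) (P1 : \sum_x P x = 1).
Hypotheses (uW : forall x, unitary (W x)) (uV : unitary V).
Hypotheses (a0 : forall x i, 0 <= a x i) (r0 : forall x i, 0 <= r x i).
Hypotheses (g0 : forall i, 0 <= gam i) (T0 : forall t, t \in T -> 0 < t).
Hypothesis s01 : 0 < s <= 1.
Hypothesis eV : \sum_x (P x)%:C%C *: udiag (W x) (a x) = udiag V gam.
(** [W x] diagonalises both the state, with eigenvalues [r x], and its power, with eigenvalues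
    [a x]; the levels in [T] dominate the former by the functions of the latter that [pgm_bound]
    controls. *)
Hypothesis ra : forall x i,
  r x i <= \sum_(t <- T) 4 * t `^ s * (a x i ^+ 2 / (a x i + t)).

Let A x := udiag (W x) (a x).
(** [mu] counts the competing messages, so [mu * gam] is the spectrum of the mean interference [D],
    and [Rt t] below is [t (D + t)^-1]. *)
Let mu : R := (M.-1)%:R.
Let Rt t := udiag V (fun i => t / (mu * gam i + t)).
Let H t x := rtr (A x *m (1%:M - Rt t)).
Let Q t x y := t^-1 * rtr (A x *m Rt t *m A y *m Rt t).

Lemma codebook_bound (c : {ffun 'I_M -> X}) : exists L : 'I_M -> 'M[C]_n,
  povm L /\ forall m,
    rtr ((1%:M - L m) *m udiag (W (c m)) (r (c m))) <=
    \sum_(t <- T) 4 * t `^ s * (H t (c m) + \sum_(k | k != m) Q t (c m) (c k)).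
Proof.
have pA m : psd (A (c m)) by exact: psd_udiag.
have pB : psd (\sum_m A (c m)) by exact: psd_sum.
have [V' [b [uV' b0 eB]]] := psdP pB.
have [L [pL hL]] := pgm_povm M0 uV' b0 pA eB.
exists L; split=> // m; move: hL; set G := udiag V' _ => hL.
pose D := 1%:M - G *m A (c m) *m G.
have eD : D = (1%:M - L m) + (L m - G *m A (c m) *m G) by rewrite addrA subrK.
have pD : psd D by rewrite eD; apply: psdD; [exact: povm_compl_psd|exact: hL].
have pr : psd (udiag (W (c m)) (r (c m))) by exact: psd_udiag.
(* Each POVM element dominates [G A_m G], so its error is at most that of the bare operator. *)
apply: (@le_trans _ _ (rtr (D *m udiag (W (c m)) (r (c m))))).
  by rewrite eD [X in _ <= rtr X]mulmxDl rtrD lerDl psd_rtrM_ge0.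
pose g t := udiag (W (c m)) (fun i => a (c m) i ^+ 2 / (a (c m) i + t)).
have eg : \sum_(t <- T) (4 * t `^ s)%:C%C *: g t = udiag (W (c m))
     (fun i => \sum_(t <- T) 4 * t `^ s * (a (c m) i ^+ 2 / (a (c m) i + t))).
  elim: (T) => [|t T' IH].
    rewrite big_nil; transitivity (udiag (W (c m)) (fun=> 0 * 1)).
      by rewrite -udiagZ scale0r.
    by apply: eq_udiag => i; rewrite big_nil mul0r.
  rewrite big_cons IH udiagZ udiagD; apply: eq_udiag => i; by rewrite big_cons.
apply: (@le_trans _ _ (rtr (D *m \sum_(t <- T) (4 * t `^ s)%:C%C *: g t))).
  rewrite -subr_ge0 -rtrB -mulmxBr eg udiagB psd_rtrM_ge0 //.
  by apply: psd_udiag => i; rewrite subr_ge0.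
rewrite rtrM_sumr !big_seq; apply: ler_sum => t tT.
have t0 := T0 tT.
rewrite -scalemxAr rtrZ ler_wpM2l ?mulr_ge0 ?powR_ge0 // rtrC.
have eRC : udiag (W (c m)) (a (c m)) + \sum_(k | k != m) A (c k) = udiag V' b.
  by rewrite -eB [in RHS](bigD1 m) //=.
have d0 i : 0 < mu * gam i + t by rewrite ltr_wpDl // mulr_ge0.
(* This supplies the conditions [R^2 <= R] and [R <= 1] of [pgm_bound]. *)
have q1 i : 0 <= t / (mu * gam i + t) <= 1.
  by rewrite divr_ge0 ?(ltW t0) ?(ltW (d0 i)) //= ler_pdivrMr // mul1r lerDr mulr_ge0.
have := @pgm_bound _ _ (W (c m)) V' (Rt t) (\sum_(k | k != m) A (c k)) (a (c m)) b t
  (uW _) uV' (a0 _) b0 t0 (adj_udiag _ _) _ _ _ eRC.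
have pC : psd (\sum_(k | k != m) A (c k)) by apply: psd_sum.
move=> pgm; apply: le_trans (pgm _ _ pC) _.
- rewrite udiagM // udiagB; apply: psd_udiag => i.
  by have /andP[q0 q1'] := q1 i; rewrite subr_ge0 ler_piMr.
- rewrite -(udiag1 uV) udiagB; apply: psd_udiag => i.
  by have /andP[_ ?] := q1 i; rewrite subr_ge0.
by rewrite lerD2l /Q -mulr_sumr -rtr_sum mulmx_sumr mulmx_suml.
Qed.

Lemma expect_H t : \sum_x P x * H t x = rtr (udiag V gam *m (1%:M - Rt t)).
Proof.
rewrite -eV mulmx_suml rtr_sum; apply: eq_bigr => x _.
by rewrite -scalemxAl rtrZ.
Qed.

Lemma expect_Q t : \sum_x \sum_y P x * P y * Q t x y =
  t^-1 * rtr (udiag V gam *m Rt t *m udiag V gam *m Rt t).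
Proof.
rewrite -[in RHS]eV !mulmx_suml rtr_sum mulr_sumr; apply: eq_bigr => x _.
rewrite mulmx_sumr mulmx_suml rtr_sum mulr_sumr; apply: eq_bigr => y _.
rewrite -!scalemxAl -!scalemxAr -!scalemxAl !rtrZ /Q.
by rewrite mulrCA !mulrA.
Qed.

(** [v] stands for the optimal error: being below the bound of every code, it is below the average
    over codebooks. The 8 is the 4 of [ra] times the 2 of [resolvent_cost]. *)
Lemma random_coding (v : R) :
  (forall (c : {ffun 'I_M -> X}) (L : 'I_M -> 'M[C]_n), povm L ->
    v <= M%:R^-1 * \sum_m rtr ((1%:M - L m) *m udiag (W (c m)) (r (c m)))) ->
  v <= 8 * (size T)%:R * mu `^ s * \sum_i gam i `^ (1 + s).
Proof.
move=> hv.
pose K := \sum_i gam i `^ (1 + s).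
pose f m (c : {ffun 'I_M -> X}) t :=
  H t (c m) + \sum_(k | k != m) Q t (c m) (c k).
have h1 c : v <= M%:R^-1 * \sum_m \sum_(t <- T) 4 * t `^ s * f m c t.
  have [L [pL hL]] := codebook_bound c.
  apply: le_trans (hv c L pL) _; rewrite ler_wpM2l ?invr_ge0 //.
  by apply: ler_sum => m _; exact: hL.
have cp0 (c : {ffun 'I_M -> X}) : 0 <= cprob P c by apply: prodr_ge0.
(* Linearity in the interference leaves only pairs of codewords; the [M - 1] equal pair averages
   supply the factor [mu]. *)
have hf m t : \sum_c cprob P c * f m c t =
   rtr (udiag V gam *m (1%:M - Rt t)) +
     mu * (t^-1 * rtr (udiag V gam *m Rt t *m udiag V gam *m Rt t)).
  rewrite /f; under eq_bigr do rewrite mulrDr mulr_sumr.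
  rewrite big_split /= (expect1 P1 (H t)) expect_H; congr (_ + _).
  rewrite exchange_big /=.
  under eq_bigr => k km do rewrite (expect2 P1 (Q t) km) expect_Q.
  by rewrite sumr_const cardC1 card_ord -mulr_natl.
have -> : v = \sum_(c : {ffun 'I_M -> X}) cprob P c * v.
  by rewrite -mulr_suml cprob_sum // mul1r.
apply: (@le_trans _ _ (\sum_(c : {ffun 'I_M -> X}) cprob P c *
    (M%:R^-1 * \sum_m \sum_(t <- T) 4 * t `^ s * f m c t))).
  by apply: ler_sum => c _; exact: ler_wpM2l.
have -> : \sum_(c : {ffun 'I_M -> X}) cprob P c *
    (M%:R^-1 * \sum_m \sum_(t <- T) 4 * t `^ s * f m c t) =
  M%:R^-1 * \sum_m \sum_(t <- T) 4 * (t `^ s * \sum_c cprob P c * f m c t).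
  under eq_bigr do rewrite mulrCA.
  rewrite -mulr_sumr; congr (_ * _).
  under eq_bigr do rewrite mulr_sumr.
  rewrite exchange_big /=; apply: eq_bigr => m _.
  under eq_bigr do rewrite mulr_sumr.
  rewrite exchange_big /=; apply: eq_bigr => t _.
  by rewrite mulrA mulr_sumr; apply: eq_bigr => c _; rewrite mulrCA.
apply: (@le_trans _ _ (M%:R^-1 * \sum_(m < M) \sum_(t <- T) 4 * (2 * mu `^ s * K))).
  rewrite ler_wpM2l ?invr_ge0 //; apply: ler_sum => m _.
  rewrite !big_seq; apply: ler_sum => t tT; rewrite hf ler_wpM2l //.
  exact: resolvent_cost (T0 tT) s01.
rewrite sumr_const card_ord big_const_seq count_predT iter_addr addr0.
rewrite -[X in _ * X <= _]mulr_natl mulKf ?pnatr_eq0 -?lt0n // -[X in X <= _]mulr_natl.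
by rewrite -/K le_eqVlt; apply/orP; left; apply/eqP; ring.
Qed.

End Bound.

End RandomCode.

(** * Tensor powers *)

Section Tensor.
Variable R : realType.
Local Notation C := R[i].

Lemma sum_enum_val (T : finType) (S : nmodType) (f : T -> S) :
  \sum_(i < #|T|) f (enum_val i) = \sum_x f x.
Proof.
rewrite [RHS](reindex (@enum_val T predT)) //=.
exact: onW_bij (@enum_val_bij T).
Qed.

Definition tens d n (F : 'I_n -> 'M[C]_d) : 'M[C]_#|{: {ffun 'I_n -> 'I_d}}| :=
  mxT (fun a b : {ffun 'I_n -> 'I_d} => \prod_(k < n) F k (a k) (b k)).

Definition tcoord d n (i : 'I_#|{: {ffun 'I_n -> 'I_d}}|) (k : 'I_n) : 'I_d :=
  (enum_val i : {ffun 'I_n -> 'I_d}) k.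

Section Fixed.
Variables (d n : nat).
Implicit Types F G : 'I_n -> 'M[C]_d.

Lemma eq_tens F G : F =1 G -> tens F = tens G.
Proof.
by move=> e; apply/matrixP=> i j; rewrite !mxE; apply: eq_bigr => k _; rewrite e.
Qed.

Lemma tensM F G : tens F *m tens G = tens (fun k => F k *m G k).
Proof.
apply/matrixP=> i j; rewrite !mxE.
under [RHS]eq_bigr do rewrite mxE.
rewrite bigA_distr_bigA -[RHS]sum_enum_val /=; apply: eq_bigr => l _.
by rewrite !mxE -big_split.
Qed.

Lemma adj_tens F : adjmx (tens F) = tens (fun k => adjmx (F k)).
Proof.
apply/matrixP=> i j; rewrite !mxE rmorph_prod.
by apply: eq_bigr => k _; rewrite mxE.
Qed.

Lemma tens_diag (l : 'I_n -> 'I_d -> R) :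
  tens (fun k => diag_mx (\row_i (l k i)%:C%C)) =
  diag_mx (\row_i (\prod_k l k (tcoord i k))%:C%C).
Proof.
apply/matrixP=> i j; rewrite !mxE; have [<-|ij] := eqVneq i j.
  rewrite mulr1n rmorph_prod; apply: eq_bigr => k _.
  by rewrite !mxE eqxx.
have /eqP/ffunP/boolp.existsNP[k hk] : enum_val i != enum_val j.
  by apply: contra ij => /eqP/enum_val_inj ->.
rewrite mulr0n (bigD1 k) //= !mxE; case: eqP => // _; by rewrite mulr0n mul0r.
Qed.

Lemma tens1 : tens (fun=> 1%:M : 'M[C]_d) = 1%:M :> 'M[C]_#|{: {ffun 'I_n -> 'I_d}}|.
Proof.
have e m : 1%:M = diag_mx (\row_(i < m) (1 : R)%:C%C).
  rewrite -diag_const_mx; congr diag_mx; apply/rowP=> i; by rewrite !mxE.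
rewrite (e d) (tens_diag (fun _ _ => 1)) e; congr diag_mx.
by apply/rowP=> i; rewrite !mxE big1.
Qed.

Lemma unitary_tens F : (forall k, unitary (F k)) -> unitary (tens F).
Proof.
move=> uF; rewrite /unitary adj_tens tensM -tens1.
by apply: eq_tens => k; exact: uF.
Qed.

Lemma tens_udiag F (l : 'I_n -> 'I_d -> R) :
  tens (fun k => udiag (F k) (l k)) =
  udiag (tens F) (fun i => \prod_k l k (tcoord i k)).
Proof.
by rewrite udiag.unlock -tens_diag adj_tens !tensM.
Qed.

Lemma trace_tens F : \tr (tens F) = \prod_k \tr (F k).
Proof.
rewrite bigA_distr_bigA -[RHS]sum_enum_val /=; apply: eq_bigr => i _.
by rewrite mxE.
Qed.

(** By distributivity the mean over independent letters is a tensor power, so its spectrum is known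
    from a single letter. *)
Lemma tens_expect (X : finType) (p : X -> R) (F : X -> 'M[C]_d) :
  \sum_(x : {ffun 'I_n -> X}) (\prod_k p (x k))%:C%C *: tens (fun k => F (x k)) =
  tens (fun=> \sum_x (p x)%:C%C *: F x).
Proof.
apply/matrixP=> i j; rewrite summxE !mxE.
under [RHS]eq_bigr do rewrite summxE.
rewrite bigA_distr_bigA; apply: eq_bigr => x _.
rewrite !mxE rmorph_prod -big_split /=.
by apply: eq_bigr => k _; rewrite mxE.
Qed.

Lemma powR_prod (I : finType) (f : I -> R) (s : R) : (forall i, 0 <= f i) ->
  (\prod_i f i) `^ s = \prod_i f i `^ s.
Proof.
move=> f0; pose Q (x y : R) := 0 <= x /\ x `^ s = y.
suff [] : Q (\prod_i f i) (\prod_i f i `^ s) by [].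
apply: big_ind2 => [|x y x' y' [x0 <-] [x0' <-]|i _]; rewrite /Q.
- by rewrite powR1.
- by rewrite mulr_ge0 // powRM.
- by rewrite f0.
Qed.

Lemma sum_prod_enum (f : 'I_n -> 'I_d -> R) :
  \sum_(i < #|{: {ffun 'I_n -> 'I_d}}|) \prod_k f k (tcoord i k) =
  \prod_k \sum_i f k i.
Proof.
rewrite bigA_distr_bigA.
exact: (@sum_enum_val {ffun 'I_n -> 'I_d} R (fun g => \prod_k f k (g k))).
Qed.

End Fixed.

Lemma two_pow_ge (y : R) : 0 < y -> (2^-1) ^+ Num.bound y^-1 <= y.
Proof.
move=> y0; have y1 : 0 <= y^-1 by rewrite invr_ge0 ltW.
rewrite exprVn -[X in _ <= X]invrK lef_pV2 ?posrE ?exprn_gt0 ?invr_gt0 //.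
apply: le_trans (ltW (archi_boundP y1)) _.
by rewrite -natrX ler_nat ltnW // ltn_expl.
Qed.

Definition dyadics (K : nat) : seq R := [seq (2^-1) ^+ j | j <- iota 0 K.+1].

(** One level suffices: the least [j] with [t = 2^-j <= y] also has [y <= 2 t]. Then [y^s <= 2 t^s],
    since [s <= 1], and [y / 2 <= y^2 / (y + t)], whence the 4. The other terms are nonnegative. *)
Lemma dyadic_cover (K : nat) (s y : R) : 0 < s <= 1 -> (2^-1) ^+ K <= y -> y <= 1 ->
  y `^ (1 + s) <= \sum_(t <- dyadics K) 4 * t `^ s * (y ^+ 2 / (y + t)).
Proof.
move=> /andP[s0 s1] yK y1.
have h2 j : 0 < (2^-1 : R) ^+ j by rewrite exprn_gt0.
have yp : 0 < y by exact: lt_le_trans yK.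
have ex : exists j, (2^-1) ^+ j <= y by exists K.
case: (ex_minnP ex) => j hj jmin.
have jK : (j <= K)%N by exact: jmin.
have hy : y <= 2 * (2^-1) ^+ j.
  (* For [j = 0] this follows from [y <= 1], otherwise from minimality of [j]. *)
  case: (j) hj jmin => [|i] hj jmin; first by rewrite expr0; lra.
  rewrite leNgt; apply/negP => h.
  have /jmin : (2^-1) ^+ i <= y by move: h; rewrite exprS; lra.
  by rewrite ltnn.
rewrite /dyadics big_map (bigD1_seq j) ?iota_uniq ?mem_iota //=.
apply: (@le_trans _ _ (4 * ((2^-1 : R) ^+ j) `^ s * (y ^+ 2 / (y + (2^-1) ^+ j)))); last first.
  rewrite lerDl sumr_ge0 // => i _.
  apply: mulr_ge0; first by rewrite mulr_ge0 ?powR_ge0.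
  by rewrite divr_ge0 ?sqr_ge0 // addr_ge0 ?(ltW yp) ?(ltW (h2 i)).
move: (h2 j) hj hy; set t := _ ^+ j => t0 ty yt.
have e1 : y `^ s <= 2 * t `^ s.
  apply: (@le_trans _ _ ((2 * t) `^ s)).
    by apply: ge0_ler_powR => //; rewrite ?nnegrE ?mulr_ge0 // ltW.
  rewrite powRM ?ler_wpM2r ?powR_ge0 // ?(ltW t0) //.
  rewrite -[X in _ <= X]powRr1 //; apply: ler_powR => //; lra.
have e2 : y / 2 <= y ^+ 2 / (y + t).
  rewrite ler_pdivlMr ?addr_gt0 // expr2; nra.
have yN0 : y != 0 by rewrite gt_eqF.
have -> : y `^ (1 + s) = y * y `^ s.
  by rewrite powRD ?yN0 ?implybT // powRr1 // ltW.
have hs : 0 <= y `^ s by exact: powR_ge0.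
have k1 := ler_wpM2l (ltW yp) e1.
have k2 := ler_wpM2r (powR_ge0 t s) e2.
lra.
Qed.

End Tensor.

(** * The error probability of a block code *)

Section ErrorProbability.
Variable R : realType.
Local Notation C := R[i].
Variables (X : finType) (d : nat) (rho : X -> 'M[C]_d).
Hypothesis drho : forall x, density (rho x).

Lemma num_msgs_gt0 n (r : R) : (0 < num_msgs n r)%N.
Proof. by rewrite /num_msgs absz_gt0 gt_eqF // ceil_gt0 powR_gt0. Qed.

(** The random coding bound involves only the [M - 1] competitors, so rounding [2^(n r)] up to an
    integer costs nothing. *)
Lemma num_msgs_pred n (r : R) : ((num_msgs n r).-1)%:R <= 2 `^ (n%:R * r) :> R.
Proof.
have h := num_msgs_gt0 n r; rewrite -subn1 natrB //.
have -> : (num_msgs n r)%:R = (Num.ceil ((2 : R) `^ (n%:R * r)))%:~R :> R.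
  by rewrite /num_msgs natr_absz ger0_norm // ltW // ceil_gt0 powR_gt0.
by have := ceilB1_lt ((2 : R) `^ (n%:R * r)); rewrite intrB => /ltW.
Qed.

Lemma eigs_density_le1 x i : 0 <= eigs (rho x) i <= 1.
Proof.
have [pr tr1] := drho x; rewrite eigs_ge0 //=.
have := rtr_udiag (eigs (rho x)) (unitary_spectralmx (rho x)).
rewrite -herm_udiag; last exact: pr.1.
rewrite /rtr tr1 /= => ->; rewrite (bigD1 i) //= lerDl.
by apply: sumr_ge0 => j _; exact: eigs_ge0.
Qed.

Section Block.
Variable n : nat.
Implicit Type c : {ffun 'I_n -> X}.

Lemma tens_stateE c : tens_state rho c =
  udiag (tens (fun k => spectralmx (rho (c k))))
        (fun i => \prod_k eigs (rho (c k)) (tcoord i k)).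
Proof.
rewrite -(tens_udiag _ (fun k i => eigs (rho (c k)) i)).
rewrite -[LHS]/(tens (fun k => rho (c k))); apply: eq_tens => k.
by apply: herm_udiag; have [[]] := drho (c k).
Qed.

Lemma rtr_tens_state c : rtr (tens_state rho c) = 1.
Proof.
rewrite -[tens_state rho c]/(tens (fun k => rho (c k))) /rtr trace_tens.
by rewrite big1 // => k _; have [] := drho (c k).
Qed.

Lemma psd_tens_state c : psd (tens_state rho c).
Proof.
rewrite tens_stateE; apply: psd_udiag => i; apply: prodr_ge0 => k _.
by have /andP[] := eigs_density_le1 (c k) (tcoord i k).
Qed.

Lemma err_probE M (c : 'I_M -> {ffun 'I_n -> X}) L : (0 < M)%N ->
  err_prob rho c L =
  M%:R^-1 * \sum_(m < M) rtr ((1%:M - L m) *m tens_state rho (c m)).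
Proof.
move=> M0; have MN0 : M%:R != 0 :> R by rewrite pnatr_eq0 -lt0n.
rewrite /err_prob; transitivity (M%:R^-1 * (M%:R - \sum_m rtr (L m *m tens_state rho (c m)))).
  by rewrite mulrBr mulVf.
congr (_ * _); under [RHS]eq_bigr do rewrite mulmxBl mul1mx rtrB rtr_tens_state.
by rewrite sumrB sumr_const card_ord.
Qed.

Lemma err_prob_ge0 M (c : 'I_M -> {ffun 'I_n -> X}) L : (0 < M)%N -> povm L ->
  0 <= err_prob rho c L.
Proof.
move=> M0 pL; rewrite err_probE // mulr_ge0 ?invr_ge0 //.
apply: sumr_ge0 => m _; apply: psd_rtrM_ge0; last exact: psd_tens_state.
exact: povm_compl_psd.
Qed.

Lemma Pe_le r (c : 'I_(num_msgs n r) -> {ffun 'I_n -> X}) L :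
  povm L -> Pe rho n r <= err_prob rho c L.
Proof.
move=> pL; apply: ge_inf; last by exists c, L.
exists 0 => _ [c' [L' [pL' ->]]]; apply: err_prob_ge0 => //.
exact: num_msgs_gt0.
Qed.

(** Always announcing message 0 is a decoder, so the infimum defining [Pe] is over a nonempty
    set. *)
Lemma first_message_povm M (M0 : (0 < M)%N) :
  povm (fun m : 'I_M => if m == Ordinal M0 then 1%:M else 0 : 'M[C]_#|{: {ffun 'I_n -> 'I_d}}|).
Proof.
split=> [m|]; first by case: ifP => _; [exact: psd1|exact: psd0].
by rewrite -big_mkcond big_pred1_eq.
Qed.

Lemma Pe_ge0 (x : X) r : 0 <= Pe rho n r.
Proof.
have M0 := num_msgs_gt0 n r; apply: lb_le_inf.
  by eexists; exists (fun=> [ffun=> x]); eexists; split; first exact: first_message_povm M0.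
by move=> _ [c [L [pL ->]]]; exact: err_prob_ge0.
Qed.

Lemma Pe_le1 (x : X) r : Pe rho n r <= 1.
Proof.
have pL := first_message_povm (num_msgs_gt0 n r).
apply: le_trans (Pe_le (fun=> [ffun=> x]) pL) _.
rewrite /err_prob gerBl mulr_ge0 ?invr_ge0 //; apply: sumr_ge0 => m _.
by apply: psd_rtrM_ge0; [exact: pL.1|exact: psd_tens_state].
Qed.

End Block.

Variables (p : X -> R) (s : R).
Hypotheses (p0 : forall x, 0 <= p x) (p1 : \sum_x p x = 1) (s01 : 0 < s <= 1).

Let al := (1 + s)^-1.
(** With [alpha = 1 / (1 + s)] this is [sum_x p_x rho_x^alpha]; the trace of its power
    [1 + s = 1 / alpha] is the one in the closed form of the Rényi information. *)
Definition tilted_mean : 'M[C]_d := \sum_x (p x)%:C%C *: mxpow (rho x) (1 + s)^-1.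
Let Gam := tilted_mean.

Lemma psd_mxpow (A : 'M[C]_d) (u : R) : psd (mxpow A u).
Proof. by rewrite /mxpow mxfunE; apply: psd_udiag => i; exact: powR_ge0. Qed.

Lemma psd_tilted_mean : psd Gam.
Proof. by apply: psd_sum => x _; apply: psdZ => //; exact: psd_mxpow. Qed.

(** [random_coding] is applied to words of length [n] as letters. [N] is fixed before [n] and [r],
    so the number of dyadic levels grows only linearly in [n]. *)
Lemma Pe_bound : exists N : nat, forall n r,
  Pe rho n r <= 8 * (n * N).+1%:R * ((num_msgs n r).-1)%:R `^ s *
                (\sum_i eigs Gam i `^ (1 + s)) ^+ n.
Proof.
have [s0 s1] := andP s01.
have al0 : 0 < al by rewrite invr_gt0 addr_gt0.
have als : al * (1 + s) = 1 by rewrite mulVf // gt_eqF // addr_gt0.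
pose lam x i := eigs (rho x) i.
have lam0 x i : 0 <= lam x i by have /andP[] := eigs_density_le1 x i.
have lam1 x i : lam x i <= 1 by have /andP[] := eigs_density_le1 x i.
(* [2^-N] lies below every nonzero eigenvalue of every [rho_x^alpha], hence [2^-(n N)] below those
   of words of length [n]. *)
pose N := \max_x \max_i Num.bound (lam x i `^ al)^-1.
have hN x i : lam x i != 0 -> (2^-1) ^+ N <= lam x i `^ al.
  move=> l0; have lp : 0 < lam x i `^ al by rewrite powR_gt0 // lt0r l0 lam0.
  apply: le_trans (two_pow_ge lp); rewrite ler_wiXn2l //; try lra.
  apply: leq_trans (leq_bigmax x); exact: (leq_bigmax i).
exists N => n r.
pose W (c : {ffun 'I_n -> X}) := tens (fun k => spectralmx (rho (c k))).
pose rr (c : {ffun 'I_n -> X}) i := \prod_k lam (c k) (tcoord i k).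
pose aa (c : {ffun 'I_n -> X}) i := \prod_k lam (c k) (tcoord i k) `^ al.
pose V := tens (fun _ : 'I_n => spectralmx Gam).
pose gam (i : 'I_#|{: {ffun 'I_n -> 'I_d}}|) := \prod_(k < n) eigs Gam (tcoord i k).
have pG := psd_tilted_mean.
have g0 i : 0 <= gam i by apply: prodr_ge0 => k _; exact: eigs_ge0.
have -> : (\sum_i eigs Gam i `^ (1 + s)) ^+ n = \sum_i gam i `^ (1 + s).
  have eg i : gam i `^ (1 + s) = \prod_k eigs Gam (tcoord i k) `^ (1 + s).
    by rewrite /gam powR_prod // => k; exact: eigs_ge0.
  under [RHS]eq_bigr do rewrite eg.
  rewrite (sum_prod_enum (fun _ i => eigs Gam i `^ (1 + s))).
  by rewrite prodr_const card_ord.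
have sz : size (dyadics R (n * N)) = (n * N).+1 by rewrite size_map size_iota.
rewrite -sz.
apply: (@random_coding _ _ _ {ffun 'I_n -> X} (fun c => \prod_k p (c k)) W aa rr V) => //.
- exact: num_msgs_gt0.
- by move=> c; apply: prodr_ge0.
- rewrite -(bigA_distr_bigA (fun _ => p)) big1 //.
- by move=> c; apply: unitary_tens => k; exact: unitary_spectralmx.
- by apply: unitary_tens => k; exact: unitary_spectralmx.
- by move=> c i; apply: prodr_ge0 => k _; exact: powR_ge0.
- by move=> c i; apply: prodr_ge0 => k _; exact: lam0.
- by move=> t /mapP[j _ ->]; rewrite exprn_gt0.
- have -> : udiag V gam = tens (fun _ : 'I_n => Gam).
    rewrite -(tens_udiag _ (fun _ i => eigs Gam i)); apply: eq_tens => k.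
    by rewrite -herm_udiag //; exact: pG.1.
  rewrite -tens_expect; apply: eq_bigr => c _; congr (_ *: _).
  rewrite -(tens_udiag _ (fun k i => lam (c k) i `^ al)); apply: eq_tens => k.
  by rewrite /mxpow mxfunE.
- move=> c i; have -> : rr c i = aa c i `^ (1 + s).
    rewrite powR_prod => [|k]; last exact: powR_ge0.
    by apply: eq_bigr => k _; rewrite -powRrM als powRr1.
  (* If one factor vanishes, both sides are 0; [dyadic_cover] treats the positive spectrum. *)
  have [/existsP[k /eqP hk]|] := boolP [exists k, lam (c k) (tcoord i k) == 0].
    have -> : aa c i = 0.
      by rewrite /aa (bigD1 k) //= hk powR0 ?mul0r // gt_eqF.
    rewrite powR0 ?gt_eqF ?addr_gt0 // big1_seq // => t _.
    by rewrite expr0n /= mul0r mulr0.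
  rewrite negb_exists => /forallP nz.
  apply: dyadic_cover => //.
    rewrite mulnC exprM -[X in _ ^+ X]card_ord -prodr_const.
    apply: ler_prod => k _; rewrite exprn_ge0 ?invr_ge0 //=; exact: hN.
  apply: prodr_ile1 => k _; rewrite powR_ge0 /=.
  have <- : 1 `^ al = 1 :> R by rewrite powR1.
  apply: ge0_ler_powR; rewrite ?nnegrE ?(ltW al0) //.
- move=> c L pL; apply: le_trans (Pe_le c pL) _.
  rewrite err_probE ?num_msgs_gt0 // ler_wpM2l ?invr_ge0 //.
  by apply: ler_sum => m _; rewrite tens_stateE.
Qed.

End ErrorProbability.

(** * The Rényi mutual information *)

Section BlockDiagonal.
Variables (R : realType) (X : finType) (d : nat).
Local Notation C := R[i].
Implicit Types F G : X -> 'M[C]_d.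

(** The direct sum along the classical register, common form of [cq_state] and [prod_state], on
    which the functional calculus acts block by block. *)
Definition blk F : 'M[C]_#|{: X * 'I_d}| :=
  mxT (fun a b : X * 'I_d => if a.1 == b.1 then F a.1 a.2 b.2 else 0).

Lemma eq_blk F G : F =1 G -> blk F = blk G.
Proof. by move=> e; apply/matrixP=> i j; rewrite !mxE e. Qed.

Lemma blkD F G : blk F + blk G = blk (fun x => F x + G x).
Proof. by apply/matrixP=> i j; rewrite !mxE; case: eqP; rewrite ?mxE ?addr0. Qed.

Lemma blkM F G : blk F *m blk G = blk (fun x => F x *m G x).
Proof.
apply/matrixP=> i j; rewrite !mxE.
set a : X * 'I_d := enum_val i; set b : X * 'I_d := enum_val j.
transitivity (\sum_(z : X * 'I_d) (if a.1 == z.1 then F a.1 a.2 z.2 else 0) *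
   (if z.1 == b.1 then G z.1 z.2 b.2 else 0)).
  rewrite -[RHS]sum_enum_val; apply: eq_bigr => l _; by rewrite !mxE.
rewrite -(pair_big xpredT xpredT (fun x k => (if a.1 == x then F a.1 a.2 k else 0) *
   (if x == b.1 then G x k b.2 else 0))) /= (bigD1 a.1) //= eqxx.
rewrite [X in _ + X]big1 ?addr0 => [|x]; last first.
  by rewrite eq_sym => /negbTE ->; rewrite big1 // => k _; rewrite mul0r.
by case: eqP => e; rewrite ?mxE // big1 // => k _; rewrite mulr0.
Qed.

Lemma adj_blk F : adjmx (blk F) = blk (fun x => adjmx (F x)).
Proof.
apply/matrixP=> i j; rewrite !mxE eq_sym.
by case: eqP => [->|_]; rewrite ?mxE ?rmorph0.
Qed.

Lemma blk_diag (l : X -> 'I_d -> R) :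
  blk (fun x => diag_mx (\row_i (l x i)%:C%C)) =
  diag_mx (\row_i (l (enum_val i : X * 'I_d).1 (enum_val i : X * 'I_d).2)%:C%C).
Proof.
apply/matrixP=> i j; rewrite !mxE; have [<-|ij] := eqVneq i j.
  by rewrite !eqxx.
have : (enum_val i : X * 'I_d) != enum_val j.
  by apply: contra ij => /eqP/enum_val_inj ->.
case: (enum_val i : X * 'I_d) (enum_val j : X * 'I_d) => [x k] [y k'] /=.
by rewrite xpair_eqE; case: eqP => //= _ /negbTE ->.
Qed.

Lemma blk1 : blk (fun=> 1%:M) = 1%:M.
Proof.
have e m : 1%:M = diag_mx (\row_(i < m) (1 : R)%:C%C).
  rewrite -diag_const_mx; congr diag_mx; apply/rowP=> i; by rewrite !mxE.
rewrite (e d) (blk_diag (fun _ _ => 1)) e; congr diag_mx.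
Qed.

Lemma unitary_blk F : (forall x, unitary (F x)) -> unitary (blk F).
Proof.
move=> uF; rewrite /unitary adj_blk blkM -blk1.
by apply: eq_blk => x; exact: uF.
Qed.

Lemma blk_udiag F (l : X -> 'I_d -> R) :
  blk (fun x => udiag (F x) (l x)) =
  udiag (blk F) (fun i => l (enum_val i : X * 'I_d).1 (enum_val i : X * 'I_d).2).
Proof. by rewrite udiag.unlock -blk_diag adj_blk !blkM. Qed.

Lemma psd_blk F : (forall x, psd (F x)) -> psd (blk F).
Proof.
move=> pF; rewrite (@eq_blk _ (fun x => udiag (spectralmx (F x)) (eigs (F x)))).
  by rewrite blk_udiag; apply: psd_udiag => i; exact: eigs_ge0.
by move=> x; apply: herm_udiag; exact: (pF x).1.
Qed.

Lemma mxfun_blk_udiag (f : R -> R) F (l : X -> 'I_d -> R) :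
  (forall x, unitary (F x)) ->
  mxfun f (blk (fun x => udiag (F x) (l x))) =
  blk (fun x => udiag (F x) (fun i => f (l x i))).
Proof.
move=> uF; rewrite blk_udiag mxfun_udiag; last exact: unitary_blk.
by rewrite (blk_udiag F (fun x i => f (l x i))).
Qed.

Lemma rtr_blk F : rtr (blk F) = \sum_x rtr (F x).
Proof.
rewrite /rtr -Re_sum; congr complex.Re.
rewrite pair_big /= -sum_enum_val; apply: eq_bigr => i _.
by rewrite mxE eqxx.
Qed.

Lemma cq_stateE (p : X -> R) F : cq_state p F = blk (fun x => (p x)%:C%C *: F x).
Proof. by apply/matrixP=> i j; rewrite !mxE. Qed.

Lemma prod_stateE (p : X -> R) (S : 'M[C]_d) :
  prod_state p S = blk (fun x => (p x)%:C%C *: S).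
Proof. by apply/matrixP=> i j; rewrite !mxE. Qed.

End BlockDiagonal.

(** * An upper bound on the Rényi information from an explicit state *)

Section MutualInformation.
Variables (R : realType) (X : finType) (d : nat).
Local Notation C := R[i].
Variables (rho : X -> 'M[C]_d) (p : X -> R) (s : R).
Hypothesis drho : forall x, density (rho x).
Hypotheses (p0 : forall x, 0 <= p x) (p1 : \sum_x p x = 1) (s01 : 0 < s <= 1).

Let al := (1 + s)^-1.
Let Gam := tilted_mean rho p s.
Let U := spectralmx Gam.
Let g := eigs Gam.
Let Q := \sum_i g i `^ (1 + s).

Let s0 : 0 < s. Proof. by have /andP[] := s01. Qed.
Let s1 : 0 < 1 + s. Proof. by rewrite addr_gt0. Qed.
Let al0 : 0 < al. Proof. by rewrite invr_gt0. Qed.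
Let al1 : al < 1. Proof. by rewrite invf_lt1 // ltrDl. Qed.
Let als : al * (1 + s) = 1. Proof. by rewrite mulVf // gt_eqF. Qed.

Let pG : psd Gam. Proof. exact: psd_tilted_mean. Qed.
Let uU : unitary U. Proof. exact: unitary_spectralmx. Qed.
Let g0 i : 0 <= g i. Proof. exact: eigs_ge0. Qed.
Let eG : Gam = udiag U g. Proof. by apply: herm_udiag; exact: pG.1. Qed.

Let lam x := eigs (rho x).
Let W x := spectralmx (rho x).
Let uW x : unitary (W x). Proof. exact: unitary_spectralmx. Qed.
Let lam0 x i : 0 <= lam x i.
Proof. by have /andP[] := eigs_density_le1 drho x i. Qed.
Let lam1 x i : lam x i <= 1.
Proof. by have /andP[] := eigs_density_le1 drho x i. Qed.
Let erho x : rho x = udiag (W x) (lam x).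
Proof. by apply: herm_udiag; have [[]] := drho x. Qed.

Let le_powR_al (y : R) : 0 <= y -> y <= 1 -> y <= y `^ al.
Proof.
move=> y0 y1; have [->|yN0] := eqVneq y 0; first exact: powR_ge0.
have yp : 0 < y by rewrite lt0r yN0.
rewrite -[X in X <= _]powRr1 // ger_powR ?yp //; exact: ltW.
Qed.

(** Spectra in [[0, 1]] give [tr rho_x^alpha >= tr rho_x = 1], hence [tr Gam >= 1], and some
    eigenvalue of [Gam] is nonzero. *)
Lemma tilted_trace_gt0 : 0 < Q.
Proof.
have h : 1 <= \sum_i g i.
  rewrite -(rtr_udiag _ uU) -eG /Gam /tilted_mean rtr_sum.
  apply: (@le_trans _ _ (\sum_x p x)); first by rewrite p1.
  apply: ler_sum => x _; rewrite rtrZ ler_peMr //.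
  have [_ tr1] := drho x.
  apply: (@le_trans _ _ (rtr (rho x))); first by rewrite /rtr tr1.
  rewrite [X in rtr X <= _]erho /mxpow mxfunE !rtr_udiag //; last exact: uW.
  by apply: ler_sum => i _; apply: le_powR_al; [exact: lam0|exact: lam1].
have [i gi] : exists i, g i != 0.
  apply/not_existsP => hh; move: h; rewrite big1 ?ler10 // => i _.
  by apply/eqP; apply: contrapT => /negP; exact: hh.
rewrite /Q (bigD1 i) //=; apply: ltr_wpDr; first by apply: sumr_ge0 => j _; exact: powR_ge0.
by rewrite powR_gt0 // lt0r gi g0.
Qed.

Let sig := udiag U (fun i => Q^-1 * g i `^ (1 + s)).

Let density_sig : density sig.
Proof.
have Q0 := tilted_trace_gt0.
have ps : psd sig.
  by apply: psd_udiag => i; rewrite mulr_ge0 ?powR_ge0 // invr_ge0 ltW.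
split=> //; have h : rtr sig = 1.
  by rewrite rtr_udiag // -mulr_sumr mulVf // gt_eqF.
(* [rtr] sees only the real part; self-adjointness makes the trace real. *)
have : (\tr sig)^* = \tr sig.
  rewrite -{2}ps.1 /mxtrace rmorph_sum /=; apply: eq_bigr => i _.
  by rewrite mxE.
move: h; rewrite /rtr; case: (\tr sig) => a b /= -> [] hb.
congr Complex; lra.
Qed.

(** Without this [petzD] would be infinite. Rows annihilated by the blocks [p_x sig] are annihilated
    by [p_x Gam], a sum of positive terms containing [p_x^2 rho_x^alpha], hence by the square root
    of that term, and so by [p_x rho_x]. *)
Let supp_sig : supp_le (cq_state p rho) (prod_state p sig).
Proof.
have Q0 := tilted_trace_gt0.
rewrite /supp_le cq_stateE prod_stateE; apply/sub_kermxP.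
set Y := kermx _.
have hY : Y *m blk (fun x => (p x)%:C%C *: sig) = 0 by exact: mulmx_ker.
(* The square root of [p_x^2 rho_x^alpha]; multiplied by [rho_x^(1 - alpha / 2)] it becomes
   [p_x rho_x]. *)
pose S := blk (fun x => udiag (W x) (fun i => p x * lam x i `^ (al / 2))).
have hS : adjmx S = S by rewrite adj_blk; apply: eq_blk => x; rewrite adj_udiag.
have YG : Y *m blk (fun x => (p x)%:C%C *: Gam) = 0.
  have <- : Y *m blk (fun x => (p x)%:C%C *: sig) *m
            blk (fun=> udiag U (fun i => Q * g i `^ (1 - (1 + s)))) =
            Y *m blk (fun x => (p x)%:C%C *: Gam).
    rewrite -mulmxA blkM; congr (_ *m _); apply: eq_blk => x.
    rewrite -scalemxAl udiagM // eG; congr (_ *: _); apply: eq_udiag => i.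
    rewrite mulrACA mulVf ?gt_eqF // mul1r.
    have [->|gN] := eqVneq (g i) 0; first by rewrite powR0 ?mul0r // gt_eqF.
    by rewrite -powRD ?gN ?implybT // addrC subrK powRr1.
  by rewrite hY mul0mx.
have YS : Y *m S = 0.
  apply: rtr_gram_eq0; rewrite adjmxM hS mulmxA -(mulmxA Y) blkM.
  pose D x := (p x)%:C%C *: \sum_(y | y != x) (p y)%:C%C *: mxpow (rho y) al.
  have pD x : psd (D x).
    by apply: psdZ => //; apply: psd_sum => y _; apply: psdZ => //; exact: psd_mxpow.
  have e : blk (fun x => (p x)%:C%C *: Gam) =
     blk (fun x => udiag (W x) (fun i => p x * lam x i `^ (al / 2)) *m
                   udiag (W x) (fun i => p x * lam x i `^ (al / 2))) + blk D.
    rewrite blkD; apply: eq_blk => x.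
    rewrite /Gam /tilted_mean (bigD1 x) //= /D scalerDr; congr (_ + _).
    rewrite udiagM // scalerA -rmorphM /= /mxpow mxfunE udiagZ -/(lam x).
    apply: eq_udiag => m.
    rewrite mulrACA; congr (_ * _).
    have -> : lam x m `^ al = (lam x m `^ (al / 2)) `^ 2%:R.
      by rewrite -powRrM divfK.
    by rewrite powR_mulrn ?powR_ge0 // expr2.
  have pY := psd_rtr_ge0 (psd_congr Y (psd_blk pD)).
  have : rtr (Y *m blk (fun x => (p x)%:C%C *: Gam) *m adjmx Y) = 0.
    by rewrite YG mul0mx rtr0.
  by rewrite e mulmxDr mulmxDl rtrD => h; lra.
have <- : Y *m S *m blk (fun x => udiag (W x) (fun i => lam x i `^ (1 - al / 2))) =
   Y *m blk (fun x => (p x)%:C%C *: rho x).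
  rewrite -mulmxA blkM; congr (_ *m _); apply: eq_blk => x.
  rewrite udiagM // [in RHS]erho udiagZ; apply: eq_udiag => i.
  rewrite -mulrA; congr (_ * _).
  have [->|lN] := eqVneq (lam x i) 0.
    by rewrite powR0 ?mul0r // gt_eqF // divr_gt0.
  by rewrite -powRD ?lN ?implybT // addrC subrK powRr1.
by rewrite YS mul0mx.
Qed.

(** An upper bound is enough, so [sig] is tried in the infimum. Since [(1 + s) (1 - alpha) = s], its
    power is [sig^(1 - alpha) = Q^(alpha - 1) Gam^s]; the weights [p_x^alpha p_x^(1 - alpha)]
    recombine to [p_x], and the trace is [Q^(alpha - 1) tr [Gam^(1 + s)] = Q^alpha]. *)
Lemma I_alpha_le :
  (I_alpha rho p al <= ((al - 1)^-1 * (al * log2 Q))%:E)%E.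
Proof.
have Q0 := tilted_trace_gt0.
apply: ereal_inf_lbound; exists sig => //; rewrite /petzD supp_sig /= lt_eqF // -/(rtr _).
suff -> : rtr (mxpow (cq_state p rho) al *m mxpow (prod_state p sig) (1 - al)) = Q `^ al.
  by rewrite /log2 ln_powR -(mulrA al).
have -> : cq_state p rho = blk (fun x => udiag (W x) (fun i => p x * lam x i)).
  by rewrite cq_stateE; apply: eq_blk => x; rewrite [in LHS]erho udiagZ.
have -> : prod_state p sig =
    blk (fun x => udiag U (fun i => p x * (Q^-1 * g i `^ (1 + s)))).
  by rewrite prod_stateE; apply: eq_blk => x; rewrite udiagZ.
rewrite /mxpow !mxfun_blk_udiag // blkM rtr_blk.
pose T := udiag U (fun i => (Q^-1 * g i `^ (1 + s)) `^ (1 - al)).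
transitivity (rtr (Gam *m T)).
  rewrite /Gam /tilted_mean mulmx_suml rtr_sum; apply: eq_bigr => x _.
  have -> : udiag (W x) (fun i => (p x * lam x i) `^ al) =
            (p x `^ al)%:C%C *: mxpow (rho x) al.
    by rewrite /mxpow mxfunE udiagZ; apply: eq_udiag => i; rewrite powRM.
  have -> : udiag U (fun i => (p x * (Q^-1 * g i `^ (1 + s))) `^ (1 - al)) =
            (p x `^ (1 - al))%:C%C *: T.
    rewrite udiagZ; apply: eq_udiag => i; rewrite powRM //.
    by rewrite mulr_ge0 ?powR_ge0 // invr_ge0 ltW.
  rewrite -!scalemxAl -scalemxAr !rtrZ mulrA; congr (_ * _).
  have [->|pN] := eqVneq (p x) 0; first by rewrite powR0 ?mul0r // gt_eqF.
  by rewrite -powRD ?pN ?implybT // addrC subrK powRr1.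
have QQ : Q = Q `^ al * Q `^ (1 - al).
  by rewrite -powRD ?(gt_eqF Q0) ?implybT // addrC subrK powRr1 // ltW.
have qN : Q `^ (1 - al) != 0 by rewrite gt_eqF // powR_gt0.
rewrite eG udiagM // rtr_udiag //.
transitivity ((Q `^ (1 - al))^-1 * Q); last first.
  by rewrite [X in _ * X]QQ mulrC mulfK.
have eQ : Q = \sum_i g i `^ (1 + s) by [].
rewrite [X in _ = _ * X]eQ mulr_sumr; apply: eq_bigr => i _.
rewrite powRM ?powR_ge0 ?invr_ge0 ?(ltW Q0) // mulrCA; congr (_ * _).
  by rewrite -powR_inv1 ?(ltW Q0) // -!powRrM -powR_inv1 ?powR_ge0 // -powRrM mulN1r mulrN1.
have [->|gN] := eqVneq (g i) 0; first by rewrite powR0 ?mul0r // gt_eqF.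
rewrite -powRrM -[X in X * _]powRr1 // -powRD ?gN ?implybT //; congr (_ `^ _).
by rewrite mulrBr mulr1 [_ * al]mulrC als; ring.
Qed.

End MutualInformation.

(** * The exponent *)

Lemma limn_einf_ge (R : realType) (u : nat -> \bar R) (L : R) :
  (forall e, 0 < e -> exists N, forall n, (N <= n)%N -> ((L - e)%:E <= u n)%E) ->
  (L%:E <= limn_einf u)%E.
Proof.
move=> h; rewrite limn_einf_lim (cvg_lim _ (@cvg_einfs_sup _ u)) //.
apply/lee_subgt0Pr => e e0; have [N hN] := h e e0.
apply: (@le_trans _ _ (einfs u N)).
  by apply: le_ereal_inf_tmp => _ [n /= Nn <-]; exact: hN.
by apply: ereal_sup_ubound; exists N.
Qed.

(** [ln y = 2 ln (sqrt y) <= 2 sqrt y], and [(2 sqrt y)^2 = 4 y <= 32 (N + 1) n <= (n e)^2] once [n]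
    exceeds [K]. *)
Lemma ln_affine_small (R : realType) (N : nat) (e : R) : 0 < e ->
  exists n0, forall n, (n0 <= n)%N -> (0 < n)%N ->
    ln (8 * (n * N).+1%:R) <= n%:R * e.
Proof.
move=> e0; pose K : R := 32 * N.+1%:R / e ^+ 2.
have K0 : 0 <= K by rewrite divr_ge0 ?sqr_ge0 // mulr_ge0.
exists (Num.bound K) => n nK n0; have := archi_boundP K0.
move=> /lt_le_trans => /(_ n%:R); rewrite ler_nat => /(_ nK).
rewrite ltr_pdivrMr ?exprn_gt0 // => hn.
have np : 0 < n%:R :> R by rewrite ltr0n.
pose y : R := 8 * (n * N).+1%:R; have y0 : 0 < y by rewrite mulr_gt0.
rewrite -/y; have sy : 0 < Num.sqrt y by rewrite sqrtr_gt0.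
have yle : y <= 8 * N.+1%:R * n%:R.
  rewrite -mulrA ler_pM2l // -natrM ler_nat mulSn mulnC.
  by rewrite -addn1 addnC leq_add2r.
have -> : ln y = 2 * ln (Num.sqrt y).
  by rewrite -[in LHS](sqr_sqrtr (ltW y0)) lnXn // mulr_natl.
apply: (@le_trans _ _ (2 * Num.sqrt y)).
  by rewrite ler_pM2l // ltW // ln_sublinear.
have h : (2 * Num.sqrt y) ^+ 2 <= (n%:R * e) ^+ 2.
  rewrite exprMn sqr_sqrtr ?(ltW y0) // exprMn.
  have := ler_wpM2l (ltW np) (ltW hn).
  rewrite expr2; nra.
by rewrite -ler_sqr ?nnegrE ?mulr_ge0 // ltW.
Qed.

(** * Asymptotics of the error probability *)

Section Main.
Variables (R : realType) (X : finType) (d : nat).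
Variables (rho : X -> 'M[R[i]]_d) (p : X -> R) (r : R).
Hypotheses (drho : forall x, density (rho x)).
Hypotheses (p0 : forall x, 0 <= p x) (p1 : \sum_(x : X) p x = 1).

Lemma alphabet_inhabited : exists x : X, True.
Proof.
apply/not_existsP => h; have := p1; rewrite big1 => [|x _]; last by case: (h x).
by move/eqP; rewrite eq_sym oner_eq0.
Qed.

Lemma err_exponent_ge0 n : (0 <= err_exponent rho r n)%E.
Proof.
rewrite /err_exponent; case: ifP => // /negbT PN.
have [x _] := alphabet_inhabited.
have P0 := Pe_ge0 drho n x r.
have P1 := Pe_le1 drho n x r.
rewrite lee_fin mulNr oppr_ge0 mulr_ge0_le0 ?invr_ge0 //.
by rewrite /log2 mulr_le0_ge0 ?ln_le0 // invr_ge0 ln_ge0 // ler1n.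
Qed.

Lemma err_exponent_ge (s : R) : 0 < s <= 1 ->
  ((- log2 (\sum_i eigs (tilted_mean rho p s) i `^ (1 + s)) - s * r)%:E <=
   limn_einf (err_exponent rho r))%E.
Proof.
move=> s01; set Q := \sum_i _; have [s0 s1] := andP s01.
have Q0 : 0 < Q by exact: tilted_trace_gt0.
have ln2 : 0 < ln 2 :> R by rewrite ln_gt0 // ltr1n.
apply: limn_einf_ge => e e0.
have [N hN] := Pe_bound drho p0 p1 s01.
(* The polynomial prefactor is absorbed into [e]; the [ln 2] accounts for logarithms to base 2. *)
have [n0 hn0] := ln_affine_small N (mulr_gt0 e0 ln2).
exists n0.+1 => n hn; have np : (0 < n)%N by exact: leq_ltn_trans hn.
have nR : 0 < n%:R :> R by rewrite ltr0n.
rewrite /err_exponent; case: ifP => [_|/negbT PN]; first exact: leey.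
have [x _] := alphabet_inhabited.
have P0 : 0 < Pe rho n r by rewrite lt0r PN (Pe_ge0 drho n x).
rewrite lee_fin.
pose b := 8 * (n * N).+1%:R : R.
have b0 : 0 < b by rewrite mulr_gt0.
pose m := (2 `^ (n%:R * r)) `^ s : R.
have m0 : 0 < m by rewrite !powR_gt0.
have Qn : 0 < Q ^+ n by rewrite exprn_gt0.
have hP : Pe rho n r <= b * m * Q ^+ n.
  apply: le_trans (hN n r) _; rewrite ler_pM2r // ler_pM2l //.
  apply: ge0_ler_powR; rewrite ?nnegrE ?powR_ge0 ?ler0n ?(ltW s0) //.
  exact: num_msgs_pred.
have : ln (Pe rho n r) <= ln b + s * (n%:R * r * ln 2) + n%:R * ln Q.
  apply: le_trans (_ : ln (b * m * Q ^+ n) <= _).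
    by rewrite ler_ln ?posrE // !mulr_gt0.
  by rewrite !lnM ?posrE ?mulr_gt0 // lnXn // /m !ln_powR -[ln Q *+ n]mulr_natl.
have hb := hn0 n (ltnW hn) np.
move=> hl.
rewrite mulNr /log2 -subr_ge0.
have -> : - (n%:R^-1 * (ln (Pe rho n r) / ln 2)) - (- (ln Q / ln 2) - s * r - e) =
  (n%:R * (e * ln 2) + s * (n%:R * r * ln 2) + n%:R * ln Q - ln (Pe rho n r)) /
  (n%:R * ln 2).
  by field; rewrite !gt_eqF.
rewrite divr_ge0 ?mulr_ge0 ?(ltW nR) ?(ltW ln2) //.
by rewrite subr_ge0; apply: le_trans hl _; rewrite !lerD2r.
Qed.

End Main.

Unset Implicit Arguments.

Theorem theorem1 (R : realType) (X : finType) (d : nat)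
    (rho : X -> 'M[R[i]]_d) (p : X -> R) (alpha r : R) :
  (forall x, density (rho x)) ->
  (forall x, 0 <= p x) -> \sum_(x : X) p x = 1 ->
  2^-1 <= alpha <= 1 -> 0 <= r ->
  (((1 - alpha) / alpha)%:E * (I_alpha rho p alpha - r%:E) <=
     limn_einf (err_exponent rho r))%E.
Proof.
move=> drho p0 p1 /andP[a_ge a_le] _.
have [->|aN1] := eqVneq alpha 1.
  (* At [alpha = 1] the left side is 0 whatever the information is, and exponents are nonnegative
     because [Pe <= 1]. *)
  rewrite subrr mul0r mul0e; apply: limn_einf_ge => e e0; exists 0%N => n _.
  apply: le_trans (err_exponent_ge0 r drho p1 n).
  by rewrite lee_fin sub0r oppr_le0 ltW.
have a1 : alpha < 1 by rewrite lt_neqAle aN1.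
have a0 : 0 < alpha by lra.
pose s := (1 - alpha) / alpha.
(* The upper bound [s <= 1] is exactly [alpha >= 1/2]. *)
have s01 : 0 < s <= 1.
  by rewrite divr_gt0 ?subr_gt0 //= ler_pdivrMr //; lra.
have sE : alpha = (1 + s)^-1 by rewrite /s; field; rewrite gt_eqF //=; lra.
apply: le_trans (err_exponent_ge r drho p0 p1 s01).
have := I_alpha_le drho p0 p1 s01; rewrite -sE => hI.
have [s0 _] := andP s01; have s0' : (0 <= s%:E)%E by rewrite lee_fin ltW.
apply: le_trans (lee_wpmul2l s0' (leeB hI (lexx r%:E))) _.
rewrite -EFinB -EFinM lee_fin; set Q := \sum_i _.
(* As [s / (alpha - 1) = - 1 / alpha], both sides equal [- log2 Q - s r]. *)
rewrite le_eqVlt; apply/orP; left; apply/eqP.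
by rewrite /s; field; rewrite gt_eqF //= subr_eq0.
Qed.
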